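(* Let $x>0$ be fixed. Then $$\lim_{t\to0^+}\mathbb{E}\left(\mathbf 1_{\{\tau_x>T_{N_t}\}}\tilde f(t-T_{N_t},x-X_{T_{N_t}})\right)=\frac{\lambda}{4}\left(F_Y(x)-F_Y(x_-)\right).$$
   Context: On a probability space $(\Omega,\mathcal F,\mathbb P)$ let $X_t=mt+W_t+\sum_{i=1}^{N_t}Y_i$, $t\ge 0$, where $m\in\mathbb{R}$, $W$ is a standard Brownian motion, $N$ is a Poisson process with constant intensity $\lambda>0$, and $(Y_i)_{i\ge1}$ are i.i.d. real random variables with distribution function $F_Y(y)=\mathbb{P}(Y_1\le y)$; $W$, $N$ and $(Y_i)_{i\ge 1}$ are independent. Let $(T_n)_{n\ge1}$ be the successive jump times of $N$ and $T_0=0$, so $T_{N_t}$ is the last jump time of $N$ in $[0,t]$ (or $0$ if there is none). For $x>0$, $\tau_x=\inf\{t\ge0: X_t\ge x\}$. $F_Y(x_-)$ is the left limit of $F_Y$ at $x$. For $u>0$ and $z\in\mathbb{R}$, $\tilde f(u,z)=\frac{|z|}{\sqrt{2\pi u^3}}\exp\left[-\frac{(z-mu)^2}{2u}\right]$, and $\tilde f(u,z)=0$ for $u\le0$. *)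

(* Defs.v *)
From HB Require Import structures.
From mathcomp Require Export all_boot all_order all_algebra.
From mathcomp Require Export all_classical all_reals all_analysis.

Set Implicit Arguments.
Unset Strict Implicit.
Unset Printing Implicit Defensive.

Import Order.TTheory GRing.Theory Num.Theory.
Import numFieldNormedType.Exports.

Local Open Scope classical_set_scope.
Local Open Scope ring_scope.

(* Processes are indexed by the whole of R so as to avoid a subtype of times,
   but every notion below only looks at times t >= 0. *)

Section independence.
Context d (T : measurableType d) (R : realType) (P : probability T R).
Local Open Scope ereal_scope.

Definition mutually_independent d' (E : measurableType d') (I : eqType)
    (X : I -> T -> E) : Prop :=
  forall (J : seq I) (A : I -> set E), uniq J ->
    (forall i, measurable (A i)) ->
    P (\big[setI/setT]_(i <- J) (X i @^-1` A i)) =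
    \prod_(i <- J) P (X i @^-1` A i).

Definition sigma_generated d' (E : measurableType d') I (D : set I)
    (X : I -> T -> E) : set_system T :=
  <<s \bigcup_(i in D) preimage_set_system setT (X i) measurable >>.

(* Each of the three sigma-algebras contains [setT], so the product rule for
   triples contains the product rules for pairs. *)
Definition independent3 (F G H : set_system T) : Prop :=
  forall A B C, F A -> G B -> H C ->
    P (A `&` B `&` C) = P A * P B * P C.

End independence.

Section processes.
Context d (T : measurableType d) (R : realType) (P : probability T R).

Definition nonneg_times : set R := [set t | 0 <= t].

(* Independence of increments is stated along an infinite sequence of times;
   sequences that are eventually constant give the usual formulation for
   finitely many times.  Path properties are only required almost surely. *)
Definition brownian_motion (W : R -> {RV P >-> R}) : Prop :=
  [/\ {ae P, forall w, W 0 w = 0 /\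
        {within nonneg_times, continuous (fun t => W t w)}},
      (forall t : nat -> R, 0 <= t 0%N -> nondecreasing_seq t ->
        mutually_independent P (fun (i : nat) w => W (t i.+1) w - W (t i) w)) &
      (forall (s t : R) (A : set R), 0 <= s -> s < t -> measurable A ->
        P [set w | A (W t w - W s w)] = normal_prob 0 (Num.sqrt (t - s)) A)].

(* The truncated subtraction of nat agrees with the true increment wherever the
   path is nondecreasing, hence almost surely. *)
Definition poisson_process (lambda : R) (N : R -> {RV P >-> nat}) : Prop :=
  [/\ {ae P, forall w, [/\ N 0 w = 0%N,
        (forall s t : R, 0 <= s -> s <= t -> (N s w <= N t w)%N) &
        (forall t : R, 0 <= t -> \forall s \near t^'+, N s w = N t w)]},
      (forall t : nat -> R, 0 <= t 0%N -> nondecreasing_seq t ->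
        mutually_independent P (fun (i : nat) w => (N (t i.+1) w - N (t i) w)%N)) &
      (forall (s t : R) (k : nat), 0 <= s -> s < t ->
        P [set w | (N t w - N s w)%N = k] =
        (poisson_pmf (lambda * (t - s)) k)%:E)].

Definition iid (Y : nat -> {RV P >-> R}) : Prop :=
  mutually_independent P (fun i : nat => Y i : T -> R) /\
  forall i (A : set R), measurable A -> P (Y i @^-1` A) = P (Y 0%N @^-1` A).

Definition independent_processes (W : R -> {RV P >-> R})
    (N : R -> {RV P >-> nat}) (Y : nat -> {RV P >-> R}) : Prop :=
  independent3 P
    (sigma_generated nonneg_times (fun t => W t : T -> R))
    (sigma_generated nonneg_times (fun t => N t : T -> nat))
    (sigma_generated setT (fun i => Y i : T -> R)).

End processes.

Section jump_diffusion.
Context (R : realType) (T : Type).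

(* [Y i] is the (i+1)-st jump size. *)
Definition jump_diffusion (m : R) (W : R -> T -> R) (N : R -> T -> nat)
    (Y : nat -> T -> R) (t : R) (w : T) : R :=
  m * t + W t w + \sum_(i < N t w) Y i w.

(* The n-th jump time of the counting process N; it is 0 for n = 0 and +oo if N
   never reaches n. *)
Definition jump_time (N : R -> T -> nat) (n : nat) (w : T) : \bar R :=
  ereal_inf [set t%:E | t in [set t : R | 0 <= t /\ (n <= N t w)%N]].

(* For t >= 0 the infimum defining [jump_time N (N t w) w] lies in [0, t], so
   [fine] loses nothing. *)
Definition last_jump_time (N : R -> T -> nat) (t : R) (w : T) : R :=
  fine (jump_time N (N t w) w).

Definition hitting_time (X : R -> T -> R) (x : R) (w : T) : \bar R :=
  ereal_inf [set t%:E | t in [set t : R | 0 <= t /\ x <= X t w]].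

Definition ftilde (m u z : R) : R :=
  if 0 < u then
    `|z| / Num.sqrt (2 * pi * u ^+ 3) * expR (- ((z - m * u) ^+ 2 / (2 * u)))
  else 0.

End jump_diffusion.

(* Main.v *)
(* Write E(t) for the expectation and T for the last jump time in [0, t].  The
   jump-free part contributes at most ftilde(t, x) -> 0 and two or more jumps
   contribute O(t), so only one jump, at a time s close to uniform on [0, t],
   matters.  Integrating ftilde(t - s, x - m s - W_s - y) against the law of W_s
   by completing the square gives a Gaussian factor of variance t evaluated near
   x - y, which kills every y <> x; for y = x, the half line where the path is
   still below x contributes e^{-m^2 t/2} / (2 pi t) * sqrt(s / (t - s)).  With
   s = t sin^2(theta) the integral over s is t times the integral of
   2 sin^2(theta) over [0, pi/2], that is t pi/2; hence lambda / 4.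
   The random time T is handled by a grid s_j = t sin^2(theta_j): the kernel with
   T frozen at a tag of its cell is a function of one Gaussian variable, one
   partial sum and an event of N, which are independent.  Fatou's lemma gives the
   upper bound; dominated convergence, with theta <= Th < pi/2 so that the kernel
   is bounded, and off the vanishing event that m s + W_s exceeds x/2 before t, give
   the lower bound. *)
From HB Require Import structures.
Require Import Defs.
From mathcomp Require Import measurable_realfun.
From mathcomp Require Import ring lra zify.

Set Implicit Arguments.
Unset Strict Implicit.
Unset Printing Implicit Defensive.

Import Order.TTheory GRing.Theory Num.Theory.
Import numFieldNormedType.Exports.

Local Open Scope classical_set_scope.
Local Open Scope ring_scope.

(** Measurability shapes the argument. The integrand contains a hitting time, an infimum over
    uncountably many times of a path that is regular only almost surely, and it is never shown
    measurable. Its expectation is a supremum of integrals of simple functions, and every comparison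
    asks for measurability of the approximation only. Both bounds are therefore proved at fixed [t],
    and [t] tends to 0 afterwards. The kernel blows up like 1/(t - s) as the jump time s approaches
    [t], so the full grid admits no constant majorant: hence two different limit theorems and two
    values of [Th]. Freezing the kernel at tags would normally cost a Riemann sum error. Tags taken
    from Cauchy's mean value theorem remove it: the weighted sums equal [alpha Th] for every mesh,
    so the integral bounds do not depend on [n]. The jump law may charge points arbitrarily close to
    [x], where the off-diagonal decay is not uniform. A bound uniform in [y] and [t], with dominated
    convergence under the jump law, takes care of them. *)

(** * Absolute and one-sided first moments of Gaussian densities *)

Section normal_integrals.
Context {R : realType}.
Local Notation mu := (@lebesgue_measure R).
Implicit Types (m s x : R).

Lemma is_derive_normal_pdf m s x : s != 0 ->
  is_derive x 1 (normal_pdf m s) (- (x - m) / s ^+ 2 * normal_pdf m s x).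
Proof.
move=> s0; rewrite normal_pdfE//.
set c := - (s ^+ 2 *+ 2)^-1.
pose q : R -> R := c \*: ((id - cst m) ^+ 2).
have dq : is_derive x 1 q (c * (2 * (x - m))).
  by apply: is_derive_eq; rewrite /GRing.scale /= expr1 subr0 mulr1.
have qE y : - (y - m) ^+ 2 / (s ^+ 2 *+ 2) = q y.
  by rewrite (_ : q y = c * (y - m) ^+ 2) // /c; ring.
rewrite /normal_fun qE.
have -> : (fun y => normal_peak s * expR (- (y - m) ^+ 2 / (s ^+ 2 *+ 2))) =
    (normal_peak s \*: (expR \o q) : R -> R).
  by apply/funext => y; rewrite qE.
have de := is_derive1_comp (is_derive_expR (q x)) dq.
by apply: is_derive_eq; rewrite /GRing.scale /= /c; field.
Qed.

Lemma cvgy_normal_pdf m s : s != 0 -> normal_pdf m s x @[x --> +oo] --> 0.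
Proof.
move=> s0; rewrite normal_pdfE//= -(mulr0 (normal_peak s)).
apply: cvgM; first exact: cvg_cst.
have s2 : 0 < s ^+ 2 by rewrite exprn_even_gt0.
suff : (x - m) ^+ 2 / (s ^+ 2 *+ 2) @[x --> +oo] --> +oo.
  move=> h; have := cvg_comp _ _ h (@cvgr_expR R).
  by apply: cvg_trans; apply: near_eq_cvg; near=> x; rewrite /normal_fun /= mulNr.
apply/cvgryPge => A; near=> x.
rewrite ler_pdivlMr ?pmulrn_lgt0//.
have : `|A * (s ^+ 2 *+ 2)| + 1 <= x - m.
  by rewrite lerBrDr; near: x; apply: nbhs_pinfty_ge; exact: num_real.
have := ler_norm (A * (s ^+ 2 *+ 2)); have := normr_ge0 (A * (s ^+ 2 *+ 2)).
by nra.
Unshelve. all: by end_near. Qed.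

(** The density times [- s ^+ 2] is an antiderivative of the integrand and vanishes at infinity. *)
Lemma integral_normal_pdf_ge m s : s != 0 ->
  (\int[mu]_(x in `[m, +oo[) ((x - m) * normal_pdf m s x)%:E =
   (s ^+ 2 * normal_peak s)%:E)%E.
Proof.
move=> s0.
pose F : R -> R := (- s ^+ 2) \*: normal_pdf m s.
have dF x : is_derive x 1 F ((x - m) * normal_pdf m s x).
  have := is_deriveZ (- s ^+ 2) (is_derive_normal_pdf m x s0).
  by move/is_derive_eq; apply; rewrite /GRing.scale/=; field.
have cn := @continuous_normal_pdf R m s s0.
have cf : continuous (fun x => (x - m) * normal_pdf m s x).
  move=> x; apply: cvgM; last exact: cn.
  by apply: cvgB; [exact: cvg_id|exact: cvg_cst].
rewrite (@ge0_continuous_FTC2y _ _ F m 0).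
- rewrite sub0e; congr EFin; rewrite /F /= normal_pdfE// /normal_fun.
  by rewrite subrr expr0n/= oppr0 mul0r expR0 /GRing.scale/=; ring.
- by move=> x xm; rewrite mulr_ge0 ?subr_ge0// normal_pdf_ge0.
- exact: continuous_subspaceT.
- have := cvgM (cvg_cst (- s ^+ 2)) (cvgy_normal_pdf m s0).
  by rewrite mulr0; apply.
- by move=> x _; case: (dF x).
- apply: cvg_at_right_filter; apply: cvgM; first exact: cvg_cst.
  exact: cn.
- by move=> x _; rewrite derive1E; apply: derive_val.
Qed.

Lemma integral_normal_pdf_le m s : s != 0 ->
  (\int[mu]_(x in `]-oo, m]) ((m - x) * normal_pdf m s x)%:E =
   (s ^+ 2 * normal_peak s)%:E)%E.
Proof.
move=> s0.
rewrite -{1}(opprK m) ge0_integration_by_substitutionNy ?opprK.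
- rewrite -(integral_normal_pdf_ge (- m) s0).
  apply: eq_integral => x _ /=; congr EFin; rewrite !normal_pdfE// /normal_fun.
  have -> : m - - x = x - - m by ring.
  have -> : - x - m = - (x - - m) by ring.
  by rewrite sqrrN.
- apply: continuous_subspaceT => x; apply: cvgM.
    by apply: cvgB; [exact: cvg_cst|exact: cvg_id].
  exact: continuous_normal_pdf.
- move=> x; rewrite in_itv/= => xm.
  by rewrite mulr_ge0 ?normal_pdf_ge0// subr_ge0 ltW.
Qed.

Lemma integral_normal_pdf_norm m s : s != 0 ->
  (\int[mu]_x (`|x - m| * normal_pdf m s x)%:E =
   (s ^+ 2 * normal_peak s *+ 2)%:E)%E.
Proof.
move=> s0.
have mf : measurable_fun setT (fun x => `|x - m| * normal_pdf m s x).
  apply: measurable_funM; last exact: measurable_normal_pdf.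
  by apply: measurableT_comp => //; exact: measurable_funB.
rewrite -(setUv `[m, +oo[%classic) ge0_integral_setU//=; last 4 first.
- exact: measurableC.
- by apply/measurable_EFinP; apply: measurable_funS mf.
- by move=> x _; rewrite lee_fin mulr_ge0 ?normal_pdf_ge0.
- exact/disj_setPCl.
rewrite setCitvr integral_itv_bndo_bndc; last first.
  by apply/measurable_EFinP; apply: measurable_funS mf.
rewrite mulr2n EFinD; congr (_ + _)%E.
- rewrite -(integral_normal_pdf_ge m s0); apply: eq_integral => x.
  by rewrite inE/= in_itv/= andbT => mx; rewrite ger0_norm// subr_ge0.
- rewrite -(integral_normal_pdf_le m s0); apply: eq_integral => x.
  rewrite inE/= in_itv/= => mx.
  by rewrite ler0_norm ?opprB// subr_le0.
Qed.

End normal_integrals.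

(** * Integration against a measure with a density *)

Section integral_density.
Context d (T : measurableType d) (R : realType).
Local Open Scope ereal_scope.
Import HBNNSimple.

(** Holds on indicators by hypothesis, then on simple functions, then by monotone convergence. It
    serves twice: for Gaussian laws against Lebesgue measure, and for the restriction of [P] to an
    event, whose density is an indicator. *)
Lemma ge0_integral_density (mu nu : {measure set T -> \bar R})
    (p : T -> R) (h : T -> \bar R) :
  measurable_fun setT p -> (forall x, (0 <= p x)%R) ->
  (forall A, measurable A -> nu A = \int[mu]_(x in A) (p x)%:E) ->
  measurable_fun setT h -> (forall x, 0 <= h x) ->
  \int[nu]_x h x = \int[mu]_x (h x * (p x)%:E).
Proof.
move=> /measurable_EFinP mp p0' nuE mh h0.
have p0 x : 0 <= (p x)%:E by rewrite lee_fin.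
pose f_ := nnsfun_approx measurableT mh.
have mf_ n : measurable_fun setT (fun x => (f_ n x)%:E).
  by apply/measurable_EFinP; exact: measurable_funP.
have f_0 n x : 0 <= (f_ n x)%:E by rewrite lee_fin.
have f_nd x a b : (a <= b)%N -> (f_ a x)%:E <= (f_ b x)%:E.
  by move=> ab; rewrite lee_fin; exact/lefP/nd_nnsfun_approx.
have f_h x : (f_ n x)%:E @[n --> \oo] --> h x by exact: cvg_nnsfun_approx.
transitivity (limn (fun n => \int[nu]_x (f_ n x)%:E)).
  rewrite -monotone_convergence//=; last by move=> x _ a b; exact: f_nd.
  by apply: eq_integral => x _; exact/esym/cvg_lim.
transitivity (limn (fun n => \int[mu]_x ((f_ n x)%:E * (p x)%:E))); last first.
  rewrite -monotone_convergence//=.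
  - apply: eq_integral => x _.
    by apply/cvg_lim => //; apply: cvgeZr => //; exact: f_h.
  - by move=> n; exact: emeasurable_funM.
  - by move=> n x _; rewrite mule_ge0.
  - by move=> x _ a b ab; rewrite lee_wpmul2r// f_nd.
congr (limn _); apply/funext => n.
under eq_integral do rewrite fimfunE -fsumEFin//.
under [RHS]eq_integral => x _.
  rewrite fimfunE -fsumEFin// ge0_mule_fsuml; last first.
    by move=> r; rewrite EFinM nnfun_muleindic_ge0.
  over.
have mi (r : R) : measurable_fun [set: T] (fun x => (r * \1_(f_ n @^-1` [set r]) x)%:E).
  exact/measurable_EFinP/measurable_funM.
rewrite !ge0_integral_fsum//; last 3 first.
- by move=> r; exact: emeasurable_funM.
- by move=> r x _; rewrite mule_ge0// EFinM nnfun_muleindic_ge0.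
- by move=> r x _; rewrite EFinM nnfun_muleindic_ge0.
apply: eq_fsbigr => r; rewrite inE => -[z _ <-].
have mj (r0 : R) : measurable_fun [set: T] (fun x => (\1_(f_ n @^-1` [set r0]) x)%:E).
  exact/measurable_EFinP.
under eq_integral do rewrite EFinM.
under [RHS]eq_integral do rewrite EFinM -muleA.
rewrite !ge0_integralZl//; last 4 first.
- by apply: emeasurable_funM.
- by move=> x _; rewrite mule_ge0// lee_fin.
- exact: f_0.
- exact: f_0.
congr (_ * _); rewrite integral_indic// setIT nuE// integral_mkcond.
apply: eq_integral => x _; rewrite patchE indicE.
by case: ifPn; rewrite ?mul1e ?mul0e.
Qed.

End integral_density.

(** * Tags that make the Riemann-Stieltjes sums exact *)

Section tags.
Context {R : realType}.
Implicit Types a b c : R.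

(** The primitive of 2 sin^2 that vanishes at 0, that is, the integral of tan against d(sin^2). *)
Definition alpha a : R := a - sin a * cos a.

Lemma alpha0 : alpha 0 = 0.
Proof. by rewrite /alpha sin0 mul0r subr0. Qed.

Lemma alpha_pihalf : alpha (pi / 2) = pi / 2.
Proof. by rewrite /alpha cos_pihalf mulr0 subr0. Qed.

Lemma is_derive_alpha a : is_derive a 1 alpha (2 * sin a ^+ 2).
Proof.
have -> : alpha = id - (sin * cos) by [].
apply: is_derive_eq; rewrite /GRing.scale/=.
by have := cos2sin2 a; rewrite !expr2 => h; ring: h.
Qed.

Lemma is_derive_sin_sqr a : is_derive a 1 (fun a => sin a ^+ 2) (2 * sin a * cos a).
Proof.
have -> : (fun a => sin a ^+ 2) = sin ^+ 2 by [].
by apply: is_derive_eq; rewrite /GRing.scale/= expr1.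
Qed.

(* With these tags, the Riemann-Stieltjes sums of [tan] against [sin ^+ 2] telescope
   exactly to [alpha], for every mesh. *)
Lemma exists_tag a b : 0 <= a -> a < b -> b <= pi / 2 ->
  exists2 c, a < c < b &
    (sin b ^+ 2 - sin a ^+ 2) * (sin c / cos c) = alpha b - alpha a.
Proof.
move=> a0 ab bpi.
have cos0 x : x \in `]a, b[ -> 0 < cos x.
  rewrite in_itv/= => /andP[ax xb]; apply: cos_gt0_pihalf; apply/andP; split; last exact: lt_le_trans bpi.
  rewrite (@lt_le_trans _ _ 0)// ?oppr_lt0 ?divr_gt0 ?pi_gt0//.
  exact: le_trans (ltW ax).
have sin0 x : x \in `]a, b[ -> 0 < sin x.
  rewrite in_itv/= => /andP[ax xb]; apply: sin_gt0_pihalf; apply/andP; split; last exact: lt_le_trans bpi.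
  exact: le_lt_trans ax.
have cont (f df : R -> R) : (forall x : R, is_derive x 1 f (df x)) -> {within `[a, b], continuous f}.
  move=> fdf; apply: continuous_subspaceT => x.
  by apply: differentiable_continuous; apply/derivable1_diffP; case: (fdf x).
(* The quotient of the two derivatives is 2 sin^2 / (2 sin cos) = tan. *)
have [|c cab E] := @cauchy_MVT _ alpha _ (fun a => sin a ^+ 2) _ a b ab
  (cont _ _ is_derive_alpha) (cont _ _ is_derive_sin_sqr)
  (fun x _ => is_derive_alpha x) (fun x _ => is_derive_sin_sqr x).
  by move=> x /[dup] /sin0 + /cos0 => s0 c0; rewrite !mulf_neq0 ?gt_eqF.
have {}E : sin c / cos c = (alpha b - alpha a) / (sin b ^+ 2 - sin a ^+ 2).
  rewrite -E; field; rewrite !gt_eqF ?sin0 ?cos0//.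
exists c; first by move: cab; rewrite in_itv.
rewrite E mulrC divfK// subr_eq0 gt_eqF//.
have r x : a <= x <= b -> x \in `[- (pi / 2), pi / 2].
  move=> /andP[ax xb]; rewrite in_itv/= (le_trans xb bpi) andbT.
  by rewrite (@le_trans _ _ 0)// ?oppr_le0 ?divr_ge0 ?pi_ge0// (le_trans a0).
have ha := r a; have hb := r b.
rewrite ltr_sqr ?nnegrE ?ltr_sin ?ha ?hb ?lexx ?(ltW ab)//.
- move: a0; rewrite le_eqVlt => /predU1P[<-|a0]; first by rewrite trigo.sin0.
  by rewrite ltW// sin_gt0_pihalf// a0 (lt_le_trans ab).
- by rewrite sin_ge0_pi// (le_trans a0 (ltW ab))/= (le_trans bpi)// ler_pdivrMr// ler_peMr ?pi_ge0// ler1n.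
Qed.

End tags.

(** * Gaussian integrals of the kernel *)

Section ftilde_normal.
Context {R : realType}.
Implicit Types m s u y a z v t : R.

Lemma normal_pdf_sqrt m v a : 0 < v ->
  normal_pdf m (Num.sqrt v) a =
  (Num.sqrt (2 * pi * v))^-1 * expR (- ((a - m) ^+ 2 / (2 * v))).
Proof.
move=> v0; rewrite normal_pdfE ?gt_eqF ?sqrtr_gt0//.
rewrite /normal_peak /normal_fun sqr_sqrtr ?ltW// mulNr.
by congr ((Num.sqrt _)^-1 * expR (- (_ / _))); ring.
Qed.

Lemma ftilde_ge0 m u z : 0 <= ftilde m u z.
Proof.
by rewrite /ftilde; case: ifP.
Qed.

Lemma measurable_ftilde m u : measurable_fun setT (ftilde m u).
Proof.
rewrite /ftilde; case: ltP => // u0.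
apply: measurable_funM.
  by apply: measurable_funM => //; exact: measurableT_comp.
apply: measurableT_comp => //; apply: measurableT_comp => //.
apply: measurable_funM => //; apply: measurable_funX.
exact: measurable_funB.
Qed.

(** Here [z] is the distance left to the level after the last jump; a hitting time later than that
    jump forces it to be positive. *)
Definition ftilde_pos m u z : R := if 0 < z then ftilde m u z else 0.

Lemma ftilde_pos_ge0 m u z : 0 <= ftilde_pos m u z.
Proof. by rewrite /ftilde_pos; case: ifP => // _; exact: ftilde_ge0. Qed.

Lemma ftilde_pos_le m u z : ftilde_pos m u z <= ftilde m u z.
Proof. by rewrite /ftilde_pos; case: ifP => // _; exact: ftilde_ge0. Qed.

Lemma measurable_ftilde_pos m u : measurable_fun setT (ftilde_pos m u).
Proof.
apply: measurable_fun_if => //; first exact: measurable_fun_ltr.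
by apply: measurable_funTS; exact: measurable_ftilde.
Qed.

(* Completing the square: the product of the Gaussian kernels of variances [u]
   and [s] is the kernel of variance [s + u] times a Gaussian density of
   variance [u * s / (s + u)]; the drift only enters through the former. *)
Lemma ftilde_normal_pdf m s u y a : 0 < s -> 0 < u ->
  let t := s + u in let c := y - m * t in
  ftilde m u (y - m * s - a) * normal_pdf 0 (Num.sqrt s) a =
  u^-1 * normal_pdf 0 (Num.sqrt t) c *
  (`|y * u / t - (a - c * s / t)| *
   normal_pdf (c * s / t) (Num.sqrt (u * s / t)) a).
Proof.
move=> s0 u0 t c; have t0 : 0 < t by rewrite addr_gt0.
have v0 : 0 < u * s / t by rewrite divr_gt0// mulr_gt0.
rewrite /ftilde u0 !normal_pdf_sqrt// !subr0.
have -> : y * u / t - (a - c * s / t) = y - m * s - a.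
  by rewrite /c /t; field; rewrite gt_eqF.
have E : expR (- ((y - m * s - a - m * u) ^+ 2 / (2 * u))) *
    expR (- (a ^+ 2 / (2 * s))) =
    expR (- (c ^+ 2 / (2 * t))) *
    expR (- ((a - c * s / t) ^+ 2 / (2 * (u * s / t)))).
  rewrite -!expRD; congr expR; rewrite /c /t; field.
  by rewrite !gt_eqF.
have p0 : 0 <= 2 * (pi : R) by rewrite mulr_ge0// pi_ge0.
have K : (Num.sqrt (2 * pi * u ^+ 3))^-1 * (Num.sqrt (2 * pi * s))^-1 =
    u^-1 * (Num.sqrt (2 * pi * t))^-1 * (Num.sqrt (2 * pi * (u * s / t)))^-1.
  have -> : Num.sqrt (2 * pi * u ^+ 3) = u * Num.sqrt (2 * pi * u).
    rewrite (_ : _ * u ^+ 3 = u ^+ 2 * (2 * pi * u)); last by ring.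
    by rewrite sqrtrM ?sqr_ge0// sqrtr_sqr gtr0_norm.
  have VM A B : 0 <= A -> (Num.sqrt A)^-1 * (Num.sqrt B)^-1 = (Num.sqrt (A * B))^-1 :> R.
    by move=> A0; rewrite sqrtrM// invfM.
  rewrite -[RHS]mulrA VM ?mulr_ge0 ?ltW ?pi_gt0// invfM -[LHS]mulrA VM ?mulr_ge0 ?ltW ?pi_gt0//.
  by congr (_ * (Num.sqrt _)^-1); field; rewrite gt_eqF.
rewrite (_ : forall A B C D F : R, A * B * C * (D * F) = (B * D) * (A * (C * F)));
  last by move=> *; ring.
by rewrite K E; ring.
Qed.

Definition gauss_bound m t y k : R :=
  normal_pdf 0 (Num.sqrt t) (y - m * t) * (`|y| / t + k).

(** After completing the square, the triangle inequality splits the absolute value into a constant,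
    integrated against mass 1, and the distance to the centre, whose mean is at most the standard
    deviation [S]. *)
Lemma integral_ftilde_le m s u y : 0 < s -> 0 < u ->
  (\int[normal_prob 0 (Num.sqrt s)]_a (ftilde m u (y - m * s - a))%:E <=
   (gauss_bound m (s + u) y (Num.sqrt s / Num.sqrt u / Num.sqrt (s + u)))%:E)%E.
Proof.
move=> s0 u0; set t := s + u; set c := y - m * t.
have t0 : 0 < t by rewrite addr_gt0.
have v0 : 0 < u * s / t by rewrite divr_gt0// mulr_gt0.
have mfs : measurable_fun setT (fun a => ftilde m u (y - m * s - a)).
  apply: measurableT_comp; first exact: measurable_ftilde.
  exact: measurable_funB.
rewrite (@ge0_integral_density _ _ _ lebesgue_measure _ (normal_pdf 0 (Num.sqrt s)))//=; last 4 first.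
- exact: measurable_normal_pdf.
- by move=> a; exact: normal_pdf_ge0.
- exact/measurable_EFinP.
- by move=> a; rewrite lee_fin ftilde_ge0.
set K := u^-1 * normal_pdf 0 (Num.sqrt t) c.
have K0 : 0 <= K by rewrite mulr_ge0 ?invr_ge0 ?normal_pdf_ge0 ?ltW.
set M := c * s / t; set S := Num.sqrt (u * s / t).
have S0 : S != 0 by rewrite gt_eqF ?sqrtr_gt0.
have mn : measurable_fun setT (fun a => `|a - M| * normal_pdf M S a).
  apply: measurable_funM; last exact: measurable_normal_pdf.
  by apply: measurableT_comp => //; exact: measurable_funB.
have mp : measurable_fun setT (fun a => (normal_pdf M S a)%:E).
  by apply/measurable_EFinP; exact: measurable_normal_pdf.
have mn' : measurable_fun setT (fun a => (`|a - M| * normal_pdf M S a)%:E).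
  exact/measurable_EFinP.
pose q := `|y| * u / t; have q0 : 0 <= q by rewrite divr_ge0 ?(ltW t0)// mulr_ge0// ltW.
apply: (@le_trans _ _ (\int[lebesgue_measure]_a (K%:E *
   (q%:E * (normal_pdf M S a)%:E + (`|a - M| * normal_pdf M S a)%:E)))%E).
  apply: ge0_le_integral => //.
  - by move=> a _; rewrite lee_fin mulr_ge0 ?ftilde_ge0 ?normal_pdf_ge0.
  - apply/measurable_EFinP; apply: measurable_funM => //.
    exact: measurable_normal_pdf.
  - by apply: emeasurable_funM => //; apply: emeasurable_funD => //; exact: emeasurable_funM.
  - move=> a _.
    rewrite [leRHS](_ : _ = (K * (q * normal_pdf M S a + `|a - M| * normal_pdf M S a))%:E)//.
    rewrite -EFinM lee_fin ftilde_normal_pdf// -/t -/c -/K -/M -/S.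
    rewrite ler_wpM2l// -mulrDl ler_wpM2r ?normal_pdf_ge0//.
    rewrite (le_trans (ler_normB _ _))// lerD2r normrM normrM.
    by rewrite (gtr0_norm u0) (@gtr0_norm _ t^-1) ?invr_gt0// lexx.
rewrite ge0_integralZl//; last 2 first.
- by apply: emeasurable_funD => //; exact: emeasurable_funM.
- move=> a _; apply: adde_ge0; last by rewrite lee_fin mulr_ge0 ?normal_pdf_ge0.
  by apply: mule_ge0; rewrite lee_fin ?normal_pdf_ge0.
rewrite ge0_integralD//; last 3 first.
- by move=> a _; rewrite -EFinM lee_fin mulr_ge0// normal_pdf_ge0.
- exact: emeasurable_funM.
- by move=> a _; rewrite lee_fin mulr_ge0// normal_pdf_ge0.
rewrite ge0_integralZl//; last first.
- by move=> a _; rewrite lee_fin normal_pdf_ge0.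
rewrite integral_normal_pdf integral_normal_pdf_norm// mule1 -EFinD -EFinM lee_fin.
rewrite /gauss_bound -/t -/c /K (mulrC u^-1) -[leLHS]mulrA ler_wpM2l ?normal_pdf_ge0//.
rewrite mulrDr lerD//; first by rewrite le_eqVlt (_ : u^-1 * _ = `|y| / t) ?eqxx// /q; field; rewrite !gt_eqF.
(* This is 2 <= sqrt(2 pi). *)
have pS : normal_peak S *+ 2 <= S^-1.
  rewrite /normal_peak -mulrnAr sqrtrM ?sqr_ge0// sqrtr_sqr.
  rewrite gtr0_norm ?sqrtr_gt0// invfM -mulrnAr ger_pMr ?invr_gt0 ?sqrtr_gt0//.
  rewrite -mulr_natr mulrC ler_pdivrMr ?mul1r; last by rewrite sqrtr_gt0 pmulrn_lgt0// pi_gt0.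
  rewrite -[leLHS](@ger0_norm R 2)// -sqrtr_sqr ler_wsqrtr//.
  by have := @pi_ge2 R; nra.
rewrite -mulrnAr; apply: (@le_trans _ _ (u^-1 * (S ^+ 2 * S^-1))).
  by rewrite ler_wpM2l ?invr_ge0 ?(ltW u0)// ler_wpM2l ?sqr_ge0.
have [u0' s0'] := (ltW u0, ltW s0).
rewrite expr2 mulfK// /S sqrtrM ?mulr_ge0// sqrtrM// sqrtrV ?(ltW t0)//.
rewrite le_eqVlt; apply/orP; left; apply/eqP.
rewrite -{1}(sqr_sqrtr (ltW u0)); field.
by rewrite !gt_eqF ?sqrtr_gt0.
Qed.

(** When the jump exactly equals the level, the half line ends at the Gaussian centre [- (m * s)],
    so the integral is an exact one-sided first moment, without error term. *)
Lemma integral_pos_ftilde m s u : 0 < s -> 0 < u ->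
  (\int[normal_prob 0 (Num.sqrt s)]_a
     (ftilde_pos m u (- (m * s) - a))%:E =
   (expR (- (m ^+ 2 * (s + u) / 2)) / (2 * pi * (s + u)) *
    (Num.sqrt s / Num.sqrt u))%:E)%E.
Proof.
move=> s0 u0; set t := s + u; set c := 0 - m * t.
have t0 : 0 < t by rewrite addr_gt0.
have v0 : 0 < u * s / t by rewrite divr_gt0// mulr_gt0.
have mfs : measurable_fun setT (fun a => ftilde_pos m u (- (m * s) - a)).
  apply: measurableT_comp; first exact: measurable_ftilde_pos.
  exact: measurable_funB.
rewrite (@ge0_integral_density _ _ _ lebesgue_measure _ (normal_pdf 0 (Num.sqrt s)))//=; last 4 first.
- exact: measurable_normal_pdf.
- by move=> a; exact: normal_pdf_ge0.
- exact/measurable_EFinP.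
- by move=> a; rewrite lee_fin ftilde_pos_ge0.
set K := u^-1 * normal_pdf 0 (Num.sqrt t) c.
have K0 : 0 <= K by rewrite mulr_ge0 ?invr_ge0 ?normal_pdf_ge0 ?ltW.
set M := c * s / t; set S := Num.sqrt (u * s / t).
have ME : M = - (m * s) by rewrite /M /c; field; rewrite gt_eqF.
have S0 : S != 0 by rewrite gt_eqF ?sqrtr_gt0.
transitivity (K%:E * \int[lebesgue_measure]_(a in `]-oo, M]) ((M - a) * normal_pdf M S a)%:E)%E.
  rewrite -ge0_integralZl//=; last 2 first.
  - apply: measurable_funTS; apply/measurable_EFinP; apply: measurable_funM.
      exact: measurable_funB.
    exact: measurable_normal_pdf.
  - by move=> a; rewrite in_itv/= => aM; rewrite lee_fin mulr_ge0 ?normal_pdf_ge0// subr_ge0.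
  rewrite [RHS]integral_mkcond; apply: eq_integral => a _.
  rewrite patchE /ftilde_pos -ME subr_gt0; case: ltP => aM; last first.
    rewrite mul0e; case: ifPn => //; rewrite inE/= in_itv/= => Ma.
    by rewrite (@le_anti _ _ a M) ?aM ?Ma// subrr mul0r mule0.
  rewrite mem_set/= ?in_itv/= ?ltW// -!EFinM ME.
  rewrite -[in ftilde _ _ _](add0r (- (m * s))) ftilde_normal_pdf// -/t -/c -/K -/M -/S.
  by rewrite !mul0r sub0r normrN ltr0_norm ?subr_lt0// opprB -ME.
rewrite integral_normal_pdf_le// -EFinM /K /S /c normal_pdf_sqrt// sqr_sqrtr ?ltW//.
rewrite /normal_peak sqr_sqrtr ?ltW//; congr EFin.
rewrite (_ : (0 - m * t - 0) ^+ 2 / (2 * t) = m ^+ 2 * t / 2); last by field; rewrite gt_eqF.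
have -> : (u * s / t * pi *+ 2) = (2 * pi * (u * s / t)) by ring.
have p0 : 0 < (pi : R) by exact: pi_gt0.
have -> : u^-1 * ((Num.sqrt (2 * pi * t))^-1 * expR (- (m ^+ 2 * t / 2))) *
  (u * s / t * (Num.sqrt (2 * pi * (u * s / t)))^-1) =
  expR (- (m ^+ 2 * t / 2)) * (s / t) *
   (Num.sqrt (2 * pi * t) * Num.sqrt (2 * pi * (u * s / t)))^-1.
  have [A0 B0] : 0 < Num.sqrt (2 * pi * t) /\ 0 < Num.sqrt (2 * pi * (u * s / t)).
    by rewrite !sqrtr_gt0 !mulr_gt0 ?invr_gt0.
  by rewrite invfM; field; rewrite !gt_eqF.
rewrite -sqrtrM; last by rewrite ltW// !mulr_gt0.
have -> : 2 * pi * t * (2 * pi * (u * s / t)) = (2 * pi) ^+ 2 * (u * s).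
  by field; rewrite gt_eqF.
rewrite sqrtrM ?sqr_ge0// sqrtr_sqr gtr0_norm ?mulr_gt0// sqrtrM ?ltW//.
move: (pi) p0 => p p0; rewrite -{1}(sqr_sqrtr (ltW s0)); field.
by rewrite !gt_eqF ?sqrtr_gt0.
Qed.

End ftilde_normal.

(** * Gaussian estimates for small times *)

Section gauss_bounds.
Context {R : realType}.
Implicit Types m y t c : R.

Lemma normal_pdf_peak_le t c : 0 < t ->
  normal_pdf 0 (Num.sqrt t) c <= (Num.sqrt t)^-1 * expR (- (c ^+ 2 / (2 * t))).
Proof.
move=> t0; rewrite normal_pdf_sqrt// subr0 ler_wpM2r ?expR_ge0//.
rewrite lef_pV2 ?posrE ?sqrtr_gt0// ?mulr_gt0 ?pi_gt0// ler_wsqrtr//.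
by have := @pi_ge2 R; nra.
Qed.

Lemma sqrt_normal_pdf_le1 t c : 0 < t -> Num.sqrt t * normal_pdf 0 (Num.sqrt t) c <= 1.
Proof.
move=> t0; rewrite mulrC -ler_pdivlMr ?sqrtr_gt0// div1r.
rewrite (le_trans (normal_pdf_peak_le c t0))// ler_piMr ?invr_ge0 ?sqrtr_ge0//.
rewrite -expR0 ler_expR oppr_le0 divr_ge0 ?sqr_ge0//.
by rewrite mulr_ge0// ltW.
Qed.

(** With a = |c| / sqrt t, use a <= 1 + a^2/2 <= e^{a^2/2}. *)
Lemma norm_normal_pdf_le1 t c : 0 < t -> `|c| * normal_pdf 0 (Num.sqrt t) c <= 1.
Proof.
move=> t0; have s0 : 0 < Num.sqrt t by rewrite sqrtr_gt0.
rewrite (le_trans (ler_wpM2l _ (normal_pdf_peak_le c t0)))// mulrA.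
rewrite -ler_pdivlMr ?expR_gt0// div1r -expRN opprK.
apply: (@le_trans _ _ (1 + c ^+ 2 / (2 * t))); last exact: expR_ge1Dx.
pose a := `|c| / Num.sqrt t.
have -> : c ^+ 2 / (2 * t) = a ^+ 2 / 2.
  by rewrite /a expr_div_n real_normK ?num_real// sqr_sqrtr ?ltW//; field; rewrite gt_eqF.
have : 0 <= a by rewrite divr_ge0// ltW.
by rewrite -/a; nra.
Qed.

(** Dominates the sum over the grid of the off-diagonal contributions: the steps add up to at most
    1, and weighted by the tangents to at most pi/2. *)
Definition gauss_sum m t y : R :=
  normal_pdf 0 (Num.sqrt t) (y - m * t) * (`|y| + Num.sqrt t * (pi / 2)).

Lemma gauss_sum_ge0 m t y : 0 <= gauss_sum m t y.
Proof.
rewrite mulr_ge0 ?normal_pdf_ge0// addr_ge0// mulr_ge0 ?sqrtr_ge0//.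
by rewrite divr_ge0 ?pi_ge0.
Qed.

Lemma measurable_gauss_sum m t : measurable_fun setT (gauss_sum m t).
Proof.
apply: measurable_funM; last exact: measurable_funD.
apply: measurableT_comp; first exact: measurable_normal_pdf.
exact: measurable_funB.
Qed.

Lemma gauss_sum_le m t y : 0 < t -> t <= 1 -> gauss_sum m t y <= 3 + `|m|.
Proof.
move=> t0 t1; rewrite /gauss_sum.
set c := y - m * t; set p := normal_pdf _ _ _.
have p0 : 0 <= p by exact: normal_pdf_ge0.
have h1 : Num.sqrt t * p <= 1 by exact: sqrt_normal_pdf_le1.
have h2 : `|c| * p <= 1 by exact: norm_normal_pdf_le1.
have ht : t <= Num.sqrt t.
  by rewrite -{1}(sqr_sqrtr (ltW t0)) expr2 ger_pMr ?sqrtr_gt0// -[leRHS]sqrtr1 ler_wsqrtr.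
have yc : `|y| <= `|c| + `|m| * Num.sqrt t.
  rewrite (_ : y = c + m * t); last by rewrite /c; ring.
  by rewrite (le_trans (ler_normD _ _))// lerD2l normrM (gtr0_norm t0) ler_wpM2l.
have := @pihalf_lt2 R; have := @pi_ge0 R; have := normr_ge0 m; have := sqrtr_ge0 t.
move: (pi / 2) (Num.sqrt t) h1 yc {ht} => b s h1 yc s0 m0 _ b2.
apply: (@le_trans _ _ (p * (`|c| + `|m| * s + s * 2))).
  by rewrite ler_wpM2l// lerD// ler_wpM2l// ltW.
have : `|m| * (s * p) <= `|m| by rewrite ler_piMr.
by nra.
Qed.

(** The drift moves the argument by at most |y|/2, so it stays at distance at least |y|/2 from 0.
    Then e^{-q} <= 2/q^2 at q = y^2/(8t) gives the order t^{3/2}, enough to absorb the factor 1/t of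
    [ftilde]; 128 is 2 * 8^2. *)
Lemma normal_pdf_off_center m t y : 0 < t -> y != 0 -> `|m| * t <= `|y| / 2 ->
  normal_pdf 0 (Num.sqrt t) (y - m * t) <= 128 / y ^+ 4 * (t * Num.sqrt t).
Proof.
move=> t0 y0 mt; set c := y - m * t.
have s0 : 0 < Num.sqrt t by rewrite sqrtr_gt0.
have y2 : 0 < y ^+ 2 by rewrite exprn_even_gt0.
have hc : y ^+ 2 / 4 <= c ^+ 2.
  have : `|y| / 2 <= `|c|.
    have : `|y| - `|m * t| <= `|c| by exact: lerB_dist.
    by rewrite normrM (gtr0_norm t0); lra.
  move=> /(lerXn2r 2); rewrite !nnegrE divr_ge0//= => /(_ isT (normr_ge0 _)).
  rewrite expr_div_n !real_normK ?num_real//.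
  by rewrite (_ : 2 ^+ 2 = 4 :> R)//; ring.
pose q := y ^+ 2 / (8 * t).
have q0 : 0 < q by rewrite divr_gt0// mulr_gt0.
apply: (le_trans (normal_pdf_peak_le c t0)).
have : expR (- (c ^+ 2 / (2 * t))) <= 2 / q ^+ 2.
  apply: (@le_trans _ _ (expR (- q))).
    rewrite ler_expR lerN2 /q ler_pdivrMr ?mulr_gt0// mulrAC -mulrA.
    rewrite (_ : 8 * t / (2 * t) = 4) ?ler_pdivrMr//; last by field; rewrite gt_eqF.
    by rewrite -ler_pdivrMr.
  have h : 1 + q ^+ 2 / 2%:R <= expR q by exact: (expR_ge1Dxn 1 (ltW q0)).
  rewrite expRN -[leRHS]invrK lef_pV2 ?posrE ?expR_gt0 ?invr_gt0 ?divr_gt0 ?exprn_gt0//.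
  by rewrite invf_div; lra.
move=> /(ler_wpM2l (ltW _)) => /(_ (Num.sqrt t)^-1); rewrite invr_gt0 => /(_ s0).
move=> /le_trans; apply.
rewrite /q le_eqVlt; apply/orP; left; apply/eqP.
rewrite -{2 3}(sqr_sqrtr (ltW t0)); field.
by rewrite y0 gt_eqF.
Qed.

Lemma cvg_sqrt0 (t : R^nat) : t n @[n --> \oo] --> 0 -> Num.sqrt (t n) @[n --> \oo] --> (0 : R).
Proof.
move=> t0; rewrite -[X in _ --> X](@sqrtr0 R).
by apply: continuous_cvg => //; exact: sqrt_continuous.
Qed.

Lemma cvg_gauss_sum m y (t : R^nat) : (forall n, 0 < t n) ->
  t n @[n --> \oo] --> 0 -> y != 0 ->
  gauss_sum m (t n) y @[n --> \oo] --> 0.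
Proof.
move=> t_gt0 t0 y0; have s0 := cvg_sqrt0 t0.
apply: (@squeeze_cvgr _ _ _ _ (cst 0)
   (fun n => 128 / y ^+ 4 * (t n * Num.sqrt (t n)) * (`|y| + Num.sqrt (t n) * (pi / 2)))).
- near=> n; rewrite gauss_sum_ge0/= ler_wpM2r//.
    by rewrite addr_ge0// mulr_ge0 ?sqrtr_ge0// divr_ge0 ?pi_ge0.
  apply: normal_pdf_off_center => //; near: n.
  have : `|m| * t n @[n --> \oo] --> `|m| * 0 by apply: cvgM => //; exact: cvg_cst.
  rewrite mulr0 => /cvgr_le; apply; rewrite divr_gt0// normr_gt0//.
- exact: cvg_cst.
- rewrite [X in _ --> X](_ : _ = 128 / y ^+ 4 * (0 * 0) * (`|y| + 0 * (pi / 2))); last by ring.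
  apply: cvgM; [apply: cvgM; [exact: cvg_cst|exact: cvgM]|].
  by apply: cvgD; [exact: cvg_cst|apply: cvgM => //; exact: cvg_cst].
Unshelve. all: by end_near. Qed.

Lemma ftilde_normal_pdfE m t y : 0 < t ->
  ftilde m t y = `|y| / t * normal_pdf 0 (Num.sqrt t) (y - m * t).
Proof.
move=> t0; rewrite /ftilde t0 normal_pdf_sqrt// subr0 [RHS]mulrA; congr (_ * _).
rewrite -[RHS]mulrA -invfM; congr (_ / _).
rewrite (_ : _ * t ^+ 3 = t ^+ 2 * (2 * pi * t)); last by ring.
by rewrite sqrtrM ?sqr_ge0// sqrtr_sqr gtr0_norm.
Qed.

Lemma cvg_ftilde m y (t : R^nat) : (forall n, 0 < t n) ->
  t n @[n --> \oo] --> 0 -> y != 0 ->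
  ftilde m (t n) y @[n --> \oo] --> 0.
Proof.
move=> t_gt0 t0 y0; have s0 := cvg_sqrt0 t0.
apply: (@squeeze_cvgr _ _ _ _ (cst 0)
   (fun n => `|y| * (128 / y ^+ 4) * Num.sqrt (t n))).
- near=> n; rewrite ftilde_ge0/= ftilde_normal_pdfE//.
  rewrite [leRHS](_ : _ = `|y| / t n * (128 / y ^+ 4 * (t n * Num.sqrt (t n)))).
    apply: ler_wpM2l; first by rewrite divr_ge0// ltW.
    apply: normal_pdf_off_center => //; near: n.
    have : `|m| * t n @[n --> \oo] --> `|m| * 0 by apply: cvgM => //; exact: cvg_cst.
    by rewrite mulr0 => /cvgr_le; apply; rewrite divr_gt0// normr_gt0//.
  by field; rewrite y0 gt_eqF.
- exact: cvg_cst.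
- rewrite -[X in _ --> X](mulr0 (`|y| * (128 / y ^+ 4))).
  by apply: cvgM => //; exact: cvg_cst.
Unshelve. all: by end_near. Qed.

(* On [u >= d], [|z| e^{-(z - m u)^2/2u} <= |z - m u| e^{-...} + |m| u]. *)
Lemma ftilde_le m d t u z : 0 < d -> d <= u -> u <= t ->
  ftilde m u z <= (1 + `|m| * Num.sqrt t) / d.
Proof.
move=> d0 du ut; have u0 : 0 < u := lt_le_trans d0 du.
rewrite ftilde_normal_pdfE//; set c := z - m * u; set p := normal_pdf _ _ _.
have h1 : Num.sqrt u * p <= 1 by exact: sqrt_normal_pdf_le1.
have h2 : `|c| * p <= 1 by exact: norm_normal_pdf_le1.
have p0 : 0 <= p by exact: normal_pdf_ge0.
have zc : `|z| <= `|c| + `|m| * u.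
  rewrite (_ : z = c + m * u); last by rewrite /c; ring.
  by rewrite (le_trans (ler_normD _ _))// normrM (gtr0_norm u0).
have zp : `|z| * p <= 1 + `|m| * Num.sqrt t.
  apply: (le_trans (ler_wpM2r p0 zc)); rewrite mulrDl lerD//.
  rewrite -mulrA ler_wpM2l//.
  rewrite -{1}(sqr_sqrtr (ltW u0)) expr2 -mulrA.
  by rewrite (le_trans (ler_wpM2l (sqrtr_ge0 _) h1))// mulr1 ler_wsqrtr.
rewrite mulrAC ler_pdivrMr// (le_trans zp)// mulrAC ler_pdivlMr//.
by rewrite ler_wpM2l// addr_ge0// mulr_ge0// sqrtr_ge0.
Qed.

End gauss_bounds.

(** * Comparison of integrals with one measurable side *)

Section lower_integral.
Context d (T : measurableType d) (R : realType).
Variable mu : {measure set T -> \bar R}.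
Local Open Scope ereal_scope.
Import HBNNSimple.

(* The integral of a nonnegative function, measurable or not, is the supremum of
   the integrals of the simple functions below it. *)
Lemma ae_le_integral_measurable_r (f g : T -> \bar R) :
  (forall x, 0 <= f x) -> (forall x, 0 <= g x) -> measurable_fun setT g ->
  {ae mu, forall x, f x <= g x} -> \int[mu]_x f x <= \int[mu]_x g x.
Proof.
move=> f0 g0 mg fg; rewrite [leLHS]ge0_integralTE//.
apply: ge_ereal_sup => _ [h /= hf <-].
rewrite -integralT_nnsfun; apply: ae_ge0_le_integral => //.
- by move=> x _; rewrite lee_fin.
- by apply/measurable_EFinP; exact: measurable_funP.
- by apply: filterS fg => x fgx _; exact: le_trans fgx.
Qed.

(** Replacing the measurable [f] by 0 on the exceptional set keeps its integral and makes the
    inequality hold everywhere; every simple function below it is then below [g]. *)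
Lemma ae_le_integral_measurable_l (f g : T -> \bar R) :
  (forall x, 0 <= f x) -> (forall x, 0 <= g x) -> measurable_fun setT f ->
  {ae mu, forall x, f x <= g x} -> \int[mu]_x f x <= \int[mu]_x g x.
Proof.
move=> f0 g0 mf [N [mN N0 fgN]].
rewrite (ge0_negligible_integral _ _ _ _ N0)// setTD integral_mkcond.
rewrite !ge0_integralTE//; last first.
  by move=> x; rewrite patchE; case: ifP.
apply: ereal_sup_le => _ [h /= hf <-]; exists h => //= x.
apply: le_trans (hf x) _; rewrite patchE; case: ifPn => //; rewrite inE => Nx.
by apply: contrapT => fgx; apply: Nx; exact: fgN.
Qed.

End lower_integral.

(** * Independent pairs on an independent event *)

Section independent_pair.
Context d (T : measurableType d) (R : realType) (P : probability T R).
Local Open Scope ereal_scope.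

(** The image under the pair of [P] restricted to [B] agrees on rectangles with [P B] times the
    product law, hence equals it; Tonelli concludes. [U] is innermost because the Gaussian integral
    is computed at a fixed sum of jumps. *)
Lemma integral_independent_pair (U V : {RV P >-> R}) (B : set T)
    (h : R * R -> \bar R) : measurable B ->
  (forall A C, measurable A -> measurable C ->
    P (B `&` (U @^-1` A) `&` (V @^-1` C)) =
    P B * distribution P U A * distribution P V C) ->
  measurable_fun setT h -> (forall z, 0 <= h z) ->
  \int[P]_w (h (U w, V w) * (\1_B w)%:E) =
  P B * \int[distribution P V]_y \int[distribution P U]_a h (a, y).
Proof.
move=> mB ind mh h0.
pose phi w := (U w, V w).
have mphi : measurable_fun setT phi by exact: measurable_fun_pair.
have PBfin : P B \is a fin_num by exact: fin_num_measure.
have PB0 : (0 <= fine (P B))%R by exact: fine_ge0.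
pose k : {nonneg R} := NngNum PB0.
have kE : k%:num%:E = P B by rewrite /k/= fineK.
pose Q : {measure set (R * R) -> \bar R} :=
  measure_function_pushforward__canonical__measure_function_Measure (mrestr P mB) mphi.
have QE X : measurable X -> Q X = mscale k (distribution P U \x distribution P V) X.
  move=> mX.
  rewrite -(@product_measure_unique _ _ _ _ _ (mscale k (distribution P U)) (distribution P V) Q)//.
    apply: product_measure_unique => // A C mA mC.
    change (k%:num%:E * (distribution P U \x distribution P V) (A `*` C) =
      k%:num%:E * distribution P U A * distribution P V C).
    by rewrite product_measure1E// muleA.
  move=> A C mA mC.
  change (P (phi @^-1` (A `*` C) `&` B) =
    k%:num%:E * distribution P U A * distribution P V C).
  rewrite kE -ind//.
  by congr (P _); apply/seteqP; split => w /=; rewrite /phi/=; tauto.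
transitivity (\int[mrestr P mB]_w (h \o phi) w).
  apply/esym; apply: ge0_integral_density.
  - exact: measurable_indic.
  - by move=> w; rewrite indicE.
  - by move=> A mA; rewrite integral_indic// setIC.
  - exact: measurableT_comp.
  - by move=> w; exact: h0.
rewrite -(preimage_setT phi) -ge0_integral_pushforward//.
rewrite (eq_measure_integral _ (fun A mA _ => QE A mA)).
by rewrite ge0_integral_mscale// kE fubini_tonelli2.
Qed.

End independent_pair.

(** * The jump of a distribution function as the mass of a point *)

Section cdf_jump.
Context d (T : measurableType d) (R : realType) (P : probability T R).
Local Open Scope ereal_scope.

(** Continuity from below along x - 1/(n+1), extended to the whole left filter by monotonicity. *)
Lemma cdf_left_lim (X : {RV P >-> R}) (x : R) :
  cdf X y @[y --> x^'-] --> P (X @^-1` `]-oo, x[).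
Proof.
have mP : P (X @^-1` `]-oo, x[) \is a fin_num.
  by apply: fin_num_measure; exact: measurable_funPTI.
have mc y : cdf X y \is a fin_num by exact: fin_num_measure.
pose v n : R := (x - n.+1%:R^-1)%R.
have vx n : (v n < x)%R by rewrite /v ltrBlDr ltrDl invr_gt0.
have cv : cdf X (v n) @[n --> \oo] --> P (X @^-1` `]-oo, x[).
  have -> : X @^-1` `]-oo, x[ = \bigcup_n (X @^-1` `]-oo, v n]).
    rewrite -preimage_bigcup; congr (_ @^-1` _); apply/seteqP; split => y /=; last first.
      by move=> [n _]/=; rewrite !in_itv/= => /le_lt_trans; exact.
    rewrite in_itv/= -subr_gt0 => xy.
    have [n _ nx] := near_infty_natSinv_lt (PosNum xy).
    exists n => //=; by have := nx n (leqnn _); rewrite /= in_itv/= /v lerBrDr -lerBrDl => /ltW.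
  have mF n : measurable (X @^-1` `]-oo, v n]) by exact: measurable_funPTI.
  apply: (@nondecreasing_cvg_mu _ _ _ P (fun n => X @^-1` `]-oo, v n])) => [//||n k nk].
  - exact: bigcup_measurable.
  - apply/subsetPset; apply: preimage_subset; apply: subset_itvl.
    by rewrite bnd_simp lerB// lef_pV2 ?posrE// ler_nat.
rewrite -(fineK mP) -[X in X @ _](_ : (EFin \o (fun y => fine (cdf X y))) = _); last first.
  by apply/funext => y /=; rewrite fineK.
apply: cvg_EFin; first by apply: nearW.
apply/cvgrPdist_le => e e0.
move: cv; rewrite -(fineK mP) => /fine_cvgP[_] /cvgrPdist_le /(_ e e0) [n _ /(_ n (leqnn _))] /= hn.
have le1 y : (y < x)%R -> (fine (cdf X y) <= fine (P (X @^-1` `]-oo, x[)))%R.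
  have mX (A : set R) : measurable A -> measurable (X @^-1` A).
    by move=> mA; exact: measurable_funPTI.
  move=> yx; apply: fine_le => //.
  apply: (@le_measure _ _ _ P (X @^-1` `]-oo, y])); rewrite ?inE; try exact: mX.
  by apply: preimage_subset => z /=; rewrite !in_itv/= => /le_lt_trans; apply.
near=> y.
have yx : (y < x)%R by near: y; exact: nbhs_left_lt.
have vy : (v n < y)%R by near: y; exact: nbhs_left_gt.
rewrite ger0_norm ?subr_ge0 ?le1//; apply: le_trans hn.
rewrite ger0_norm ?subr_ge0 ?le1// lerB//.
by apply: fine_le => //; apply: cdf_nondecreasing; exact: ltW.
Unshelve. all: by end_near. Qed.

Lemma cdf_jump (X : {RV P >-> R}) (x : R) :
  cdf X x - lim (cdf X y @[y --> x^'-]) = P (X @^-1` [set x]).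
Proof.
have mo : measurable (X @^-1` `]-oo, x[) by exact: measurable_funPTI.
have m1 : measurable (X @^-1` [set x]) by exact: measurable_funPTI.
rewrite (cvg_lim _ (@cdf_left_lim X x))//.
have -> : cdf X x = P (X @^-1` `]-oo, x[) + P (X @^-1` [set x]).
  rewrite -measureU//; last first.
    by apply/seteqP; split => // w [] /=; rewrite in_itv/= => + wx; rewrite wx ltxx.
  rewrite -preimage_setU; congr (P (X @^-1` _)).
  apply/seteqP; split => [y|y []] /=; rewrite ?in_itv/=.
  - by rewrite le_eqVlt => /predU1P[->|]; [right|left].
  - by move/ltW.
  - by move=> ->.
rewrite addeAC subee ?add0e//; exact: fin_num_measure.
Qed.

End cdf_jump.

(** * Probabilities for the position of the last Poisson jump *)

Section poisson_increments.
Context d (T : measurableType d) (R : realType) (P : probability T R).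
Variables (lambda : R) (N : R -> {RV P >-> nat}).
Hypotheses (lambda_gt0 : 0 < lambda) (poissonN : poisson_process lambda N).
Local Open Scope ereal_scope.

Let PU2 (A B : set T) : measurable A -> measurable B ->
  P (A `|` B) <= P A + P B.
Proof. exact: measureU2. Qed.

Definition incr (a b : R) (w : T) : nat := (N b w - N a w)%N.

Lemma measurable_incr (a b : R) (A : set nat) : measurable (incr a b @^-1` A).
Proof.
rewrite -[X in measurable X]setTI.
by apply: measurable_fun_subn.
Qed.

Lemma incr_refl (a : R) w : incr a a w = 0%N. Proof. exact: subnn. Qed.

Lemma P_incr0 (a b : R) : (0 <= a)%R -> (a <= b)%R ->
  P (incr a b @^-1` [set 0%N]) = (expR (- (lambda * (b - a))))%:E.
Proof.
move=> a0; rewrite le_eqVlt => /predU1P[<-|ab].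
  rewrite subrr mulr0 oppr0 expR0 -[RHS](@probability_setT _ _ _ P).
  by congr (P _); apply/seteqP; split => w //= _; exact: incr_refl.
have [_ _ /(_ a b 0%N a0 ab)] := poissonN; rewrite /poisson_pmf.
by rewrite mulr_gt0 ?subr_gt0// expr0 fact0 invr1 !mul1r.
Qed.

Lemma P_incr1 (a b : R) : (0 <= a)%R -> (a < b)%R ->
  P (incr a b @^-1` [set 1%N]) =
  (lambda * (b - a) * expR (- (lambda * (b - a))))%:E.
Proof.
move=> a0 ab; have [_ _ /(_ a b 1%N a0 ab)] := poissonN; rewrite /poisson_pmf.
by rewrite mulr_gt0 ?subr_gt0// expr1 invr1 mulr1.
Qed.

Lemma P_incr_ge1 (a b : R) : (0 <= a)%R -> (a <= b)%R ->
  P (incr a b @^-1` [set k | (1 <= k)%N]) <= (lambda * (b - a))%:E.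
Proof.
move=> a0 ab.
have -> : incr a b @^-1` [set k | (1 <= k)%N] = ~` (incr a b @^-1` [set 0%N]).
  by apply/seteqP; split => w /=; rewrite lt0n => /eqP.
rewrite probability_setC; last exact: measurable_incr.
rewrite P_incr0// -EFinB lee_fin lerBlDr -lerBlDl.
by have := expR_ge1Dx (- (lambda * (b - a))); rewrite mulrBr.
Qed.

Lemma P_incr_ge2 (a b : R) : (0 <= a)%R -> (a <= b)%R ->
  P (incr a b @^-1` [set k | (2 <= k)%N]) <= ((lambda * (b - a)) ^+ 2)%:E.
Proof.
move=> a0; rewrite le_eqVlt => /predU1P[<-|ab].
  rewrite (_ : _ @^-1` _ = set0) ?measure0 ?lee_fin ?sqr_ge0//.
  by apply/seteqP; split => w //=; rewrite incr_refl.
have -> : incr a b @^-1` [set k | (2 <= k)%N] =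
    ~` (incr a b @^-1` [set 0%N] `|` incr a b @^-1` [set 1%N]).
  apply/seteqP; split => w /=; case: incr => [|[|k]]//=.
  - by move=> _ [].
  - by case; left.
  - by case; right.
rewrite probability_setC; last by apply: measurableU; exact: measurable_incr.
have -> : P (incr a b @^-1` [set 0%N] `|` incr a b @^-1` [set 1%N]) =
    (expR (- (lambda * (b - a))) + lambda * (b - a) * expR (- (lambda * (b - a))))%:E.
  rewrite EFinD -(P_incr0 a0 (ltW ab)) -(P_incr1 a0 ab).
  apply: measureU; [exact: measurable_incr|exact: measurable_incr|].
  by apply/seteqP; split => w //= [-> ].
rewrite -EFinB lee_fin.
set q := (lambda * (b - a))%R.
have q0 : (0 <= q)%R by rewrite mulr_ge0 ?subr_ge0 ?ltW.
(* 1 - e^{-q} (1 + q) <= 1 - (1 - q) (1 + q) = q^2. *)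
have := expR_ge1Dx (- q); have := expR_gt0 (- q).
move: (expR (- q)) => e e0 e1; nra.
Qed.

Lemma incr_indep (a b c : R) (A B C : set nat) :
  (0 <= a)%R -> (a <= b)%R -> (b <= c)%R ->
  P (incr 0 a @^-1` A `&` incr a b @^-1` B `&` incr b c @^-1` C) =
  P (incr 0 a @^-1` A) * P (incr a b @^-1` B) * P (incr b c @^-1` C).
Proof.
move=> a0 ab bc; have [_ indep _] := poissonN.
(* The default value of [nth] makes the sequence constant equal to [c] from index 3 on; below, the
   default of [D] plays the part of the third set. *)
pose t (i : nat) : R := nth c [:: 0%R; a; b] i.
have t0 : (0 <= t 0%N)%R by [].
have tnd : nondecreasing_seq t.
  apply/nondecreasing_seqP => -[|[|[|n]]] //=; rewrite /t/= ?nth_nil//.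
pose D (i : nat) : set nat := nth C [:: A; B] i.
have := indep t t0 tnd [:: 0; 1; 2]%N D isT (fun _ => I).
rewrite !big_cons !big_nil setIT mule1 => E.
by rewrite -setIA -muleA; exact: E.
Qed.

(* The last jump before time t is the k-th and lies in ]a, b]. *)
Definition last_jump_in (a b t : R) (k : nat) : set T :=
  N a @^-1` [set i | (i < k)%N] `&` N b @^-1` [set k] `&` N t @^-1` [set k].

Lemma measurable_last_jump_in a b t k : measurable (last_jump_in a b t k).
Proof.
by apply: measurableI; [apply: measurableI|]; exact: measurable_funPTI.
Qed.

Lemma P_last_jump_in1_le a b t : (0 <= a)%R -> (a <= b)%R ->
  P (last_jump_in a b t 1) <= (lambda * (b - a))%:E.
Proof.
move=> a0 ab; apply: le_trans (P_incr_ge1 a0 ab).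
apply: le_measure; rewrite ?inE; [exact: measurable_last_jump_in|exact: measurable_incr|].
by move=> w [[/= Na Nb] _]; rewrite /incr Nb subn_gt0.
Qed.

(** Either there is a jump in ]0, a] and another in ]a, b], or at least two in ]a, b]: a (b - a) +
    (b - a)^2 = b (b - a). The factor b - a makes the bound summable over cells, and b <= t will
    offset the 1/t of the kernel. *)
Lemma P_last_jump_in_ge2_le a b t : (0 <= a)%R -> (a <= b)%R ->
  \sum_(k <oo) P (last_jump_in a b t k.+2) <= (lambda ^+ 2 * b * (b - a))%:E.
Proof.
move=> a0 ab.
pose E1 := incr 0 a @^-1` [set k | (1 <= k)%N] `&` incr a b @^-1` [set k | (1 <= k)%N]
  `&` incr b b @^-1` setT.
pose E2 := incr a b @^-1` [set k | (2 <= k)%N].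
have mE1 : measurable E1 by apply: measurableI; [apply: measurableI|]; exact: measurable_incr.
have mE2 : measurable E2 by exact: measurable_incr.
have [[Z [mZ Z0 NZ]] _ _] := poissonN.
have -> : \sum_(k <oo) P (last_jump_in a b t k.+2) =
    P (\bigcup_k last_jump_in a b t k.+2).
  rewrite measure_bigcup//=; first by apply: eq_eseriesl => k; rewrite in_setT.
    by move=> k _; exact: measurable_last_jump_in.
  apply/trivIsetP => i j _ _ ij; apply/seteqP; split => w //=.
  by move=> [[_ /= Nti] [_ /= Ntj]]; move: ij; rewrite -eqSS -eqSS -Nti -Ntj eqxx.
apply: (@le_trans _ _ (P (E1 `|` E2 `|` Z))).
  apply: le_measure; rewrite ?inE.
  - by apply: bigcup_measurable => k _; exact: measurable_last_jump_in.
  - by apply: measurableU => //; exact: measurableU.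
  move=> w [k _ [[/= Na Nb] _]].
  have [wZ|wZ] := pselect (Z w); [by right|left].
  have N0 : N 0 w = 0%N.
    by apply: contrapT => h; apply: wZ; apply: NZ => -[].
  case Ea : (N a w) => [|n]; [right|left].
    by rewrite /E2/= /incr Ea Nb.
  by rewrite /E1/= /incr Ea N0 Nb/=; split => //; split => //; rewrite subn_gt0 -Ea.
rewrite (le_trans (PU2 _ _))//; first exact: measurableU.
rewrite Z0 adde0 (le_trans (PU2 _ _))//.
have -> : (lambda ^+ 2 * b * (b - a) =
   lambda * (a - 0) * (lambda * (b - a)) + (lambda * (b - a)) ^+ 2)%R by ring.
rewrite EFinD leeD ?P_incr_ge2// /E1 incr_indep// preimage_setT probability_setT mule1.
by rewrite EFinM lee_pmul// P_incr_ge1.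
Qed.

(** No jump up to [a], one in ]a, b], none in ]b, t]: the three exponentials multiply to e^{-lambda
    t}. *)
Lemma P_last_jump_in1_ge a b t : (0 <= a)%R -> (a < b)%R -> (b <= t)%R ->
  (lambda * (b - a) * expR (- (lambda * t)))%:E <= P (last_jump_in a b t 1).
Proof.
move=> a0 ab bt.
pose E := incr 0 a @^-1` [set 0%N] `&` incr a b @^-1` [set 1%N]
  `&` incr b t @^-1` [set 0%N].
have mE : measurable E by apply: measurableI; [apply: measurableI|]; exact: measurable_incr.
have [[Z [mZ Z0 NZ]] _ _] := poissonN.
apply: (@le_trans _ _ (P E)).
  rewrite /E incr_indep ?(ltW ab)// P_incr0// P_incr1// P_incr0 ?(le_trans a0 (ltW ab))//.
  rewrite -!EFinM lee_fin le_eqVlt; apply/orP; left; apply/eqP.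
  rewrite (_ : - (lambda * t) = - (lambda * (a - 0)) - (lambda * (b - a)) - lambda * (t - b))%R.
    by rewrite !expRD; ring.
  by ring.
apply: (@le_trans _ _ (P (last_jump_in a b t 1 `|` Z))); last first.
  rewrite (le_trans (PU2 _ _))//; first exact: measurable_last_jump_in.
  by rewrite Z0 adde0.
apply: le_measure; rewrite ?inE//.
  by apply: measurableU => //; exact: measurable_last_jump_in.
move=> w [[/= E1 E2] E3].
have [wZ|wZ] := pselect (Z w); [by right|left].
have [N0 Nnd _] : [/\ N 0 w = 0%N,
        (forall s t : R, 0 <= s -> s <= t -> (N s w <= N t w)%N)%R &
        (forall t : R, 0 <= t -> \forall s \near t^'+, N s w = N t w)%R].
  by apply: contrapT => h; apply: wZ; apply: NZ.
have := Nnd b t (le_trans a0 (ltW ab)) bt.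
have := Nnd _ _ a0 (ltW ab).
move: E1 E2 E3; rewrite /incr /last_jump_in/= N0 => E1 E2 E3 h1 h2.
by split; [split|]; move: E1 E2 E3 h1 h2; rewrite /=; lia.
Qed.

End poisson_increments.

(** * Generated sigma-algebras and sums of jumps *)

Section sigma_generated_theory.
Context d (T : measurableType d) d' (E : measurableType d') (I : Type) (D : set I).
Variable X : I -> T -> E.

(** Seen as a [g_sigma_algebraType] on these sets, the generated sigma-algebra inherits the general
    closure results on measurable sets and functions. *)
Definition generators : set_system T :=
  \bigcup_(i in D) preimage_set_system setT (X i) measurable.

Lemma sigma_generatedE (A : set T) :
  sigma_generated D X A = @measurable _ (g_sigma_algebraType generators) A.
Proof. by []. Qed.

Lemma measurable_fun_generators i : D i ->
  measurable_fun setT (X i : g_sigma_algebraType generators -> E).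
Proof.
move=> Di _ A mA; apply: sub_sigma_algebra; exists i => //.
by exists A.
Qed.

Lemma sigma_generated_preimage i (A : set E) : D i -> measurable A ->
  sigma_generated D X (X i @^-1` A).
Proof.
move=> Di mA; rewrite sigma_generatedE -[X in measurable X]setTI.
exact: measurable_fun_generators.
Qed.

Lemma sigma_generatedI (A B : set T) : sigma_generated D X A ->
  sigma_generated D X B -> sigma_generated D X (A `&` B).
Proof. by rewrite !sigma_generatedE; exact: measurableI. Qed.

Lemma sigma_generatedC (A : set T) : sigma_generated D X A ->
  sigma_generated D X (~` A).
Proof. by rewrite !sigma_generatedE; exact: measurableC. Qed.

Lemma sigma_generatedT : sigma_generated D X setT.
Proof. by rewrite sigma_generatedE; exact: measurableT. Qed.

Lemma sigma_generated_bigcup_rat (F : rat -> set T) :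
  (forall q, sigma_generated D X (F q)) -> sigma_generated D X (\bigcup_q F q).
Proof.
by move=> h; rewrite sigma_generatedE; apply: bigcupT_measurable_rat.
Qed.

End sigma_generated_theory.

Section partial_sum.
Context d (T : measurableType d) (R : realType) (P : probability T R).
Variable Y : nat -> {RV P >-> R}.

Definition partial_sum (k : nat) (w : T) : R := \sum_(i < k) Y i w.

Lemma measurable_partial_sum k : measurable_fun setT (partial_sum k).
Proof. exact: measurable_sum. Qed.

HB.instance Definition _ k :=
  isMeasurableFun.Build _ _ _ _ (partial_sum k) (measurable_partial_sum k).

Lemma sigma_generated_partial_sum k (A : set R) : measurable A ->
  sigma_generated setT (fun i => Y i : T -> R) (partial_sum k @^-1` A).
Proof.
move=> mA; rewrite sigma_generatedE -[X in measurable X]setTI.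
have : measurable_fun setT
  (partial_sum k : g_sigma_algebraType (generators setT (fun i => Y i : T -> R)) -> R).
  apply: measurable_sum => i.
  exact: (@measurable_fun_generators _ _ _ _ _ setT (fun i => Y i : T -> R)).
exact.
Qed.

End partial_sum.

(** * Brownian marginals and excursions in small time *)

Section brownian.
Context d (T : measurableType d) (R : realType) (P : probability T R).
Variable W : R -> {RV P >-> R}.
Hypothesis brownianW : brownian_motion W.
Local Open Scope ereal_scope.

Lemma distribution_brownian (s : R) (A : set R) : (0 < s)%R -> measurable A ->
  distribution P (W s) A = normal_prob 0 (Num.sqrt s) A.
Proof.
move=> s0 mA; have [[Z [mZ Z0 WZ]] _ /(_ 0%R s A (lexx _) s0 mA)] := brownianW.
rewrite subr0 => <-; rewrite /distribution /pushforward.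
have mB : measurable [set w | A (W s w - W 0 w)%R].
  rewrite -[X in measurable X]setTI.
  by apply: (measurable_funB (@measurable_funPT _ _ _ _ (W s)) (measurable_funPT (W 0))).
have mC : measurable (W s @^-1` A) by exact: measurable_funPTI.
have H w : ~ Z w -> (W s w - W 0 w)%R = W s w.
  move=> wZ; rewrite (_ : W 0 w = 0%R) ?subr0//.
  by apply: contrapT => h; apply: wZ; apply: WZ => -[].
have le (B C : set T) : measurable B -> measurable C -> B `<=` C `|` Z -> P B <= P C.
  move=> mB' mC' BC; apply: (@le_trans _ _ (P (C `|` Z))).
    by apply: le_measure; rewrite ?inE//; exact: measurableU.
  have : P (C `|` Z) <= P C + P Z by exact: measureU2.
  by rewrite Z0 adde0.
apply/eqP; rewrite eq_le !le//.
- move=> w; have [wZ|wZ] := pselect (Z w); [by right|left].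
  by have := H w wZ; rewrite /= => <-.
- move=> w; have [wZ|wZ] := pselect (Z w); [by right|left].
  by have := H w wZ; rewrite /= => ->.
Qed.

(** Rational times make this a countable union, hence an event of the sigma-algebra of [W];
    continuity of paths later recovers the other times. *)
Definition exceeds (m c t : R) : set T :=
  \bigcup_(q : rat) [set w | ((0 : R) <= ratr q <= t)%R /\ (c < m * ratr q + W (ratr q) w)%R].

Lemma sigma_generated_exceeds m c t :
  sigma_generated (@nonneg_times R) (fun t => W t : T -> R) (exceeds m c t).
Proof.
apply: sigma_generated_bigcup_rat => q.
have [/andP[q0 qt]|qt] := pselect ((0 : R) <= ratr q <= t)%R; last first.
  rewrite (_ : [set w | _] = ~` setT); last by apply/seteqP; split => w //= [].
  by apply: sigma_generatedC; exact: sigma_generatedT.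
rewrite (_ : [set w | _] = W (ratr q) @^-1` `](c - m * ratr q)%R, +oo[); last first.
  apply/seteqP; split => w /=; rewrite in_itv/= andbT ltrBlDl; first by case.
  by rewrite q0 qt.
exact: (@sigma_generated_preimage _ _ _ _ _ _ (fun t => W t : T -> R)).
Qed.

Lemma measurable_exceeds m c t : measurable (exceeds m c t).
Proof.
apply: bigcupT_measurable_rat => q.
have [/andP[q0 qt]|qt] := pselect ((0 : R) <= ratr q <= t)%R; last first.
  by rewrite (_ : [set w | _] = set0)//; apply/seteqP; split => w //= [].
rewrite (_ : [set w | _] = W (ratr q) @^-1` `](c - m * ratr q)%R, +oo[); last first.
  apply/seteqP; split => w /=; rewrite in_itv/= andbT ltrBlDl; first by case.
  by rewrite q0 qt.
exact: measurable_funPTI.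
Qed.

Lemma le_exceeds m c s t : (s <= t)%R -> exceeds m c s `<=` exceeds m c t.
Proof.
move=> st w [q _ [/= /andP[q0 qs] h]]; exists q => //=; split => //.
by rewrite q0 (le_trans qs st).
Qed.

(** The events shrink with the time horizon. A path lying in all of them would have values above c >
    0 at times tending to 0, against continuity at 0, so their intersection is null. *)
Lemma cvg_P_exceeds (m c : R) (t : R^nat) : (0 < c)%R -> t n @[n --> \oo] --> (0%R : R) ->
  P (exceeds m c (t n)) @[n --> \oo] --> 0.
Proof.
move=> c0 t0.
pose F k := exceeds m c k.+1%:R^-1.
have mF k : measurable (F k) by exact: measurable_exceeds.
have F0 : P (F k) @[k --> \oo] --> 0.
  suff <- : P (\bigcap_k F k) = 0.
    apply: nonincreasing_cvg_mu => //.
    - by rewrite -ge0_fin_numE// fin_num_measure.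
    - exact: bigcap_measurable.
    - move=> a b ab; apply/subsetPset; apply: le_exceeds.
      by rewrite lef_pV2 ?posrE// ler_nat.
  have [[Z [mZ Z0 WZ]] _ _] := brownianW.
  apply/eqP; rewrite eq_le measure_ge0 andbT -Z0.
  apply: le_measure; rewrite ?inE//; first exact: bigcap_measurable.
  move=> w Fw; apply: WZ => /= -[W0 Wc].
  have /cvgrPdist_lt : (m * s + W s w)%R @[s --> within (@nonneg_times R) (nbhs (0%R : R))] --> (m * 0 + W 0 w)%R.
    apply: cvgD; last by move/subspace_continuousP : Wc; apply; exact: lexx.
    by apply: cvgM; [exact: cvg_cst|exact: cvg_within].
  move=> /(_ c c0) -[e /= e0 he].
  have [k _ hk] := near_infty_natSinv_lt (PosNum e0).
  have [q _ [/= /andP[q0 qk] hq]] := Fw k I.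
  have Bq : ball_ Num.norm (0%R : R) e (ratr q).
    by rewrite /= sub0r normrN ger0_norm//; exact: le_lt_trans qk (hk k (leqnn _)).
  have := he (ratr q) Bq q0.
  rewrite mulr0 W0 addr0 sub0r normrN => /ltr_normlW /lt_gtF.
  by rewrite hq.
have fE s : P (exceeds m c s) \is a fin_num.
  by apply: fin_num_measure; exact: measurable_exceeds.
apply/fine_cvgP; split; first by apply: nearW => n; exact: fE.
apply/cvgrPdist_le => e e0.
move: F0 => /fine_cvgP[_] /cvgrPdist_le /(_ e e0) [k _ /(_ k (leqnn _))] /=.
rewrite sub0r normrN ger0_norm ?fine_ge0// => hk.
near=> n; rewrite sub0r normrN ger0_norm ?fine_ge0//; apply: le_trans hk.
apply: fine_le => //; first exact: fE.
apply: le_measure; rewrite ?inE; [exact: measurable_exceeds|exact: mF|].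
apply: le_exceeds; near: n.
by move/cvgr_le : t0; apply; rewrite invr_gt0.
Unshelve. all: by end_near. Qed.

End brownian.

(** * Product formulas from the independence of the three sources *)

Section independence_formula.
Context d (T : measurableType d) (R : realType) (P : probability T R).
Variables (W : R -> {RV P >-> R}) (N : R -> {RV P >-> nat}) (Y : nat -> {RV P >-> R}).
Hypotheses (brownianW : brownian_motion W) (indepWNY : independent_processes W N Y).
Local Open Scope ereal_scope.

Lemma sigma_generated_last_jump_in a b t k : (0 <= a)%R -> (0 <= b)%R -> (0 <= t)%R ->
  sigma_generated (@nonneg_times R) (fun t => N t : T -> nat) (last_jump_in N a b t k).
Proof.
by move=> a0 b0 t0; apply: sigma_generatedI; [apply: sigma_generatedI|];
  apply: (@sigma_generated_preimage _ _ _ _ _ _ (fun t => N t : T -> nat)).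
Qed.

Lemma integral_indep (s : R) (k : nat) (B : set T) (h : R * R -> R) :
  (0 < s)%R -> measurable B ->
  sigma_generated (@nonneg_times R) (fun t => N t : T -> nat) B ->
  measurable_fun setT h -> (forall z, (0 <= h z)%R) ->
  \int[P]_w ((h (W s w, partial_sum Y k w))%:E * (\1_B w)%:E) =
  P B * \int[distribution P (partial_sum Y k)]_y
     \int[normal_prob 0 (Num.sqrt s)]_a (h (a, y))%:E.
Proof.
move=> s0 mB gB mh h0.
rewrite (@integral_independent_pair _ _ _ P (W s) (partial_sum Y k) B (EFin \o h))//.
- congr (_ * _); apply: eq_integral => y _.
  (* Pushing forward along the identity carries [normal_prob] from one presentation of the Borel
     structure on the line to the one carrying the law of [W s]. *)
  have mid : measurable_fun setT (idfun : measurableTypeR R -> R).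
    by move=> _ A mA; rewrite setTI.
  have mhy : measurable_fun setT (fun a => (h (a, y))%:E).
    by apply/measurable_EFinP; apply: measurableT_comp => //; exact: measurable_fun_pair.
  pose m2 : {measure set R -> \bar R} :=
    measure_function_pushforward__canonical__measure_function_Measure
      (normal_prob 0 (Num.sqrt s)) mid.
  transitivity (\int[m2]_a (h (a, y))%:E).
    by apply: eq_measure_integral => A mA _; exact: distribution_brownian.
  rewrite ge0_integral_pushforward//.
  by move=> a _; rewrite lee_fin.
- move=> A C mA mC; have := indepWNY; rewrite /independent_processes /independent3.
  have gW := @sigma_generated_preimage _ _ _ _ _ (@nonneg_times R)
    (fun t => W t : T -> R) s A (ltW s0) mA.
  have gS := @sigma_generated_partial_sum _ _ _ _ Y k C mC.
  move=> /(_ _ _ _ gW gB gS) E.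
  rewrite (setIC B) (muleC (P B)) -[RHS]muleA [in RHS](muleC (distribution P (W s) A)).
  by rewrite [LHS]E /distribution /pushforward; rewrite -muleA muleC -!muleA.
- exact/measurable_EFinP.
Qed.

Lemma P_indep_exceeds m c t (B : set T) :
  sigma_generated (@nonneg_times R) (fun t => N t : T -> nat) B ->
  P (B `&` exceeds W m c t) = P B * P (exceeds W m c t).
Proof.
move=> gB; have := indepWNY; rewrite /independent_processes /independent3.
move=> /(_ (exceeds W m c t) B setT).
rewrite setIT probability_setT mule1 setIC muleC; apply => //.
- exact: sigma_generated_exceeds.
- exact: sigma_generatedT.
Qed.

End independence_formula.

(** * Paths of counting processes and first passage, deterministically *)

Section counting_paths.
Context (R : realType) (T : Type) (N : R -> T -> nat) (w : T).
Hypothesis N0 : N 0 w = 0%N.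
Hypothesis N_nd : forall s t : R, 0 <= s -> s <= t -> (N s w <= N t w)%N.
Hypothesis N_rc : forall t : R, 0 <= t -> \forall s \near t^'+, N s w = N t w.

(** Right continuity makes the infimum attained: the count has its final value already at [tau].
    Positivity of [tau] then follows from [N0]. *)
Lemma last_jump_time_spec (t : R) : 0 <= t -> (0 < N t w)%N ->
  let tau := last_jump_time N t w in
  [/\ 0 < tau, tau <= t, N tau w = N t w &
      forall s, 0 <= s -> s < tau -> (N s w < N t w)%N].
Proof.
move=> t0 Nt; rewrite /last_jump_time /jump_time.
set S := [set s : R | 0 <= s /\ (N t w <= N s w)%N].
have St : S t by split.
have lS : lbound S 0 by move=> s [].
have hS : has_inf S by split; [exists t|exists 0].
rewrite ereal_inf_EFin/=; [|by case: hS|by case: hS].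
set tau := inf S.
have tau0 : 0 <= tau by apply: lb_le_inf => //; case: hS.
have taut : tau <= t by apply: ge_inf => //; case: hS.
have Ntau : N tau w = N t w.
  apply/eqP; rewrite eqn_leq N_nd//=.
  have [e /= e0 he] := N_rc tau0.
  have [s [s0 Ns] se] := inf_adherent e0 hS.
  have : tau <= s by apply: ge_inf => //; case: hS.
  rewrite le_eqVlt => /predU1P[->//|taus]; rewrite -(he s)//=.
  by rewrite distrC ger0_norm ?subr_ge0 ?(ltW taus)// ltrBlDl.
split => //.
- rewrite lt_neqAle tau0 andbT; apply/eqP => tau_0.
  by move: Ntau; rewrite -tau_0 N0 => h; move: Nt; rewrite -h.
- move=> s s0 stau; rewrite ltnNge; apply/negP => Ns.
  by move: stau; rewrite ltNge => /negP; apply; apply: ge_inf => //; case: hS.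
Qed.

Lemma last_jump_time_no_jump (t : R) : N t w = 0%N -> last_jump_time N t w = 0.
Proof.
move=> Nt; rewrite /last_jump_time /jump_time Nt.
set S := [set s : R | 0 <= s /\ (0 <= N s w)%N].
have S0 : S 0 by split.
have lS : lbound S 0 by move=> s [].
rewrite ereal_inf_EFin/=; [|by exists 0|by exists 0].
apply/eqP; rewrite eq_le; apply/andP; split.
  by apply: ge_inf => //; exists 0.
by apply: lb_le_inf => //; exists 0.
Qed.

(** Turns the position of a random time into a condition on [N] at three fixed times, which is where
    independence can be used. *)
Lemma last_jump_inP (a b t : R) (k : nat) : 0 <= a -> a <= b -> b <= t ->
  (0 < N t w)%N ->
  let tau := last_jump_time N t w in
  [/\ (N a w < k)%N, N b w = k & N t w = k] <->
  N t w = k /\ a < tau <= b.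
Proof.
move=> a0 ab bt Nt tau.
have t0 : 0 <= t by rewrite (le_trans a0)// (le_trans ab).
have [tau0 taut Ntau hlt] := last_jump_time_spec t0 Nt; rewrite -/tau in tau0 taut Ntau hlt.
split.
- move=> [Na Nb Ntk]; split=> //; apply/andP; split.
  + rewrite ltNge; apply/negP => taua.
    by have := N_nd (ltW tau0) taua; rewrite Ntau Ntk leqNgt Na.
  + rewrite leNgt; apply/negP => btau.
    by have := hlt b (le_trans a0 ab) btau; rewrite Nb Ntk ltnn.
- move=> [Ntk /andP[atau taub]]; split=> //.
  + by rewrite -Ntk; exact: hlt.
  + apply/eqP; rewrite -Ntk eqn_leq N_nd ?(le_trans a0 ab)//=.
    by rewrite -Ntau N_nd// ltW.
Qed.

End counting_paths.

Section hitting.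
Context (R : realType) (T : Type) (X : R -> T -> R) (x : R) (w : T).

Lemma lt_hitting_time (s : R) : 0 <= s -> (s%:E < hitting_time X x w)%E -> X s w < x.
Proof.
move=> s0; apply: contraTT; rewrite -leNgt -leNgt => xX.
by apply: ereal_inf_lbound; exists s.
Qed.

Lemma hitting_time_gt (s r : R) : s < r ->
  (forall q, 0 <= q -> q < r -> X q w < x) -> (s%:E < hitting_time X x w)%E.
Proof.
move=> sr h; apply: (@lt_le_trans _ _ r%:E); first by rewrite lte_fin.
apply: le_ereal_inf_tmp => _ [q [q0 xq] <-]; rewrite lee_fin leNgt.
by apply/negP => /(h _ q0); rewrite ltNge xq.
Qed.

End hitting.

(** * Continuity of the kernels at positive remaining time *)

Section kernel_continuity.
Context {R : realType}.
Implicit Types (m u z : R).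

Let kernel m u z : R := (Num.sqrt (2 * pi * u ^+ 3))^-1 * expR (- ((z - m * u) ^+ 2 / (2 * u))).

Let cvg_expr k (u_ : R^nat) u : u_ n @[n --> \oo] --> u ->
  u_ n ^+ k @[n --> \oo] --> u ^+ k.
Proof.
move=> cu; exact: (cvg_comp u_ (fun v : R => v ^+ k) cu (@exprn_continuous R k u)).
Qed.

Let cvg_kernel m u z (u_ z_ : R^nat) : 0 < u -> u_ n @[n --> \oo] --> u -> z_ n @[n --> \oo] --> z ->
  kernel m (u_ n) (z_ n) @[n --> \oo] --> kernel m u z.
Proof.
move=> u0 cu cz.
have u3 : Num.sqrt (2 * pi * u ^+ 3) != 0.
  by rewrite gt_eqF// sqrtr_gt0 !mulr_gt0 ?pi_gt0 ?exprn_gt0.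
apply: cvgM.
  apply: cvgV => //; apply: continuous_cvg; first exact: sqrt_continuous.
  apply: cvgM; first exact: cvg_cst.
  exact: cvg_expr.
apply: continuous_cvg; first exact: continuous_expR.
apply: cvgN; apply: cvgM.
  apply: cvg_expr.
  by apply: cvgB => //; apply: cvgM => //; exact: cvg_cst.
apply: cvgV; first by rewrite mulf_neq0// gt_eqF.
by apply: cvgM => //; exact: cvg_cst.
Qed.

Let ftildeE m u z : 0 < u -> ftilde m u z = `|z| * kernel m u z.
Proof. by move=> u0; rewrite /ftilde u0 /kernel [RHS]mulrA. Qed.

Let ftilde_posE m u z : 0 < u -> ftilde_pos m u z = (z + `|z|) / 2 * kernel m u z.
Proof.
move=> u0; rewrite /ftilde_pos ftildeE//; case: ltP => z0.
  by rewrite gtr0_norm// mulrDl -splitr.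
by rewrite ler0_norm// subrr !mul0r.
Qed.

Lemma cvg_ftilde_cont m u z (u_ z_ : R^nat) : 0 < u -> (forall n, 0 < u_ n) ->
  u_ n @[n --> \oo] --> u -> z_ n @[n --> \oo] --> z ->
  ftilde m (u_ n) (z_ n) @[n --> \oo] --> ftilde m u z.
Proof.
move=> u0 un0 cu cz; rewrite ftildeE//.
under eq_fun do rewrite ftildeE//.
by apply: cvgM; [exact: cvg_norm|exact: cvg_kernel].
Qed.

(** The cut-off creates no discontinuity at z = 0, since it replaces |z| by the positive part (z +
    |z|)/2. *)
Lemma cvg_ftilde_pos_cont m u z (u_ z_ : R^nat) : 0 < u -> (forall n, 0 < u_ n) ->
  u_ n @[n --> \oo] --> u -> z_ n @[n --> \oo] --> z ->
  ftilde_pos m (u_ n) (z_ n) @[n --> \oo] --> ftilde_pos m u z.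
Proof.
move=> u0 un0 cu cz; rewrite ftilde_posE//.
under eq_fun do rewrite ftilde_posE//.
apply: cvgM; last exact: cvg_kernel.
apply: cvgM; last exact: cvg_cst.
by apply: cvgD => //; exact: cvg_norm.
Qed.

End kernel_continuity.

(** * The trigonometric grid *)

Section grid.
Context {R : realType}.
Implicit Types (a b t : R) (n j : nat).

Definition tag a b : R := xget 0 [set c | a < c < b /\
  (sin b ^+ 2 - sin a ^+ 2) * (sin c / cos c) = alpha b - alpha a].

Lemma tagP a b : 0 <= a -> a < b -> b <= pi / 2 ->
  a < tag a b < b /\
  (sin b ^+ 2 - sin a ^+ 2) * (sin (tag a b) / cos (tag a b)) = alpha b - alpha a.
Proof.
move=> a0 ab bpi; rewrite /tag; case: xgetP => [c -> //|].
by have [c cab E] := exists_tag a0 ab bpi => /(_ c) /= []; split.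
Qed.

Lemma sin_sqr_le a b : 0 <= a -> a <= b -> b <= pi / 2 -> sin a ^+ 2 <= sin b ^+ 2.
Proof.
move=> a0 ab bpi.
have sin0 x : 0 <= x <= pi / 2 -> 0 <= sin x.
  move=> /andP[x0 xpi]; rewrite sin_ge0_pi// x0 (le_trans xpi)//.
  by rewrite ler_pdivrMr// ler_peMr ?pi_ge0// ler1n.
have r x : 0 <= x <= pi / 2 -> x \in `[- (pi / 2), pi / 2].
  move=> /andP[x0 xpi]; rewrite in_itv/= xpi andbT.
  by rewrite (@le_trans _ _ 0)// oppr_le0 divr_ge0 ?pi_ge0.
have ha : 0 <= a <= pi / 2 by rewrite a0 (le_trans ab).
have hb : 0 <= b <= pi / 2 by rewrite bpi (le_trans a0).
rewrite ler_sqr ?nnegrE ?sin0//; move: ab; rewrite le_eqVlt => /predU1P[->//|ab].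
by rewrite ltW// ltr_sin ?r.
Qed.

Lemma sin_sqr_lip a b : a <= b -> sin b ^+ 2 - sin a ^+ 2 <= 2 * (b - a).
Proof.
rewrite le_eqVlt => /predU1P[->|ab]; first by rewrite !subrr mulr0.
have [|c _ ->] := @MVT _ (fun a => sin a ^+ 2) _ a b ab (fun x _ => is_derive_sin_sqr x).
  apply: continuous_subspaceT => x.
  by apply: differentiable_continuous; apply/derivable1_diffP; case: (is_derive_sin_sqr x).
rewrite ler_wpM2r ?subr_ge0 ?(ltW ab)//.
have := cos2Dsin2 c; have := sqr_ge0 (sin c - cos c); nra.
Qed.

(** [Th] is pi/2 for the upper bound, whose grid must reach time t, and smaller for the lower bound,
    whose kernel must stay bounded. *)
Definition theta (Th : R) n j : R := Th * (j%:R / n.+1%:R).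

Lemma theta0 Th n : theta Th n 0 = 0.
Proof. by rewrite /theta mul0r mulr0. Qed.

Lemma thetan Th n : theta Th n n.+1 = Th.
Proof. by rewrite /theta divff ?mulr1// pnatr_eq0. Qed.

Lemma theta_ge0 Th n j : 0 <= Th -> 0 <= theta Th n j.
Proof. by move=> Th0; rewrite mulr_ge0// divr_ge0. Qed.

Lemma theta_le Th n j k : 0 <= Th -> (j <= k)%N -> theta Th n j <= theta Th n k.
Proof. by move=> Th0 jk; rewrite ler_wpM2l// ler_wpM2r ?invr_ge0// ler_nat. Qed.

Lemma thetaS_lt Th n j : 0 < Th -> theta Th n j < theta Th n j.+1.
Proof. by move=> Th0; rewrite ltr_pM2l// ltr_pM2r ?invr_gt0// ltr_nat. Qed.

Lemma thetaSB Th n j : theta Th n j.+1 - theta Th n j = Th / n.+1%:R.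
Proof. by rewrite /theta -mulrBr -mulrBl -natrB// subSnn mul1r. Qed.

Definition gtag (Th : R) n j : R := tag (theta Th n j) (theta Th n j.+1).

Definition step (Th : R) n j : R := sin (theta Th n j.+1) ^+ 2 - sin (theta Th n j) ^+ 2.

Section gridTh.
Variables (Th : R).
Hypotheses (Th0 : 0 < Th) (Thpi : Th <= pi / 2).

Lemma thetaS_pihalf n j : (j < n.+1)%N -> theta Th n j.+1 <= pi / 2.
Proof.
by move=> jn; rewrite (le_trans _ Thpi)// -[leRHS](thetan Th n) theta_le// ltW.
Qed.

Lemma gtagP n j : (j < n.+1)%N ->
  theta Th n j < gtag Th n j < theta Th n j.+1 /\
  step Th n j * (sin (gtag Th n j) / cos (gtag Th n j)) =
  alpha (theta Th n j.+1) - alpha (theta Th n j).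
Proof.
move=> jn; apply: tagP; [exact/theta_ge0/ltW|exact: thetaS_lt|exact: thetaS_pihalf].
Qed.

Lemma gtag_itv n j : (j < n.+1)%N -> 0 < gtag Th n j < Th.
Proof.
move=> jn; have [/andP[h1 h2] _] := gtagP jn.
rewrite (le_lt_trans _ h1) ?theta_ge0 ?(ltW Th0)//=.
by rewrite (lt_le_trans h2)// -[leRHS](thetan Th n) theta_le// ltW.
Qed.

Lemma sin_gtag_gt0 n j : (j < n.+1)%N -> 0 < sin (gtag Th n j).
Proof.
by move=> /gtag_itv /andP[h1 h2]; rewrite sin_gt0_pihalf// h1 (lt_le_trans h2).
Qed.

Lemma cos_gtag_gt0 n j : (j < n.+1)%N -> 0 < cos (gtag Th n j).
Proof.
move=> /gtag_itv /andP[h1 h2]; rewrite cos_gt0_pihalf// (lt_le_trans h2)// andbT.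
by rewrite (lt_trans _ h1)// oppr_lt0 divr_gt0 ?pi_gt0.
Qed.

Lemma step_ge0 n j : (j < n.+1)%N -> 0 <= step Th n j.
Proof.
move=> jn; rewrite subr_ge0 sin_sqr_le//; [exact/theta_ge0/ltW|exact/ltW/thetaS_lt|].
exact: thetaS_pihalf.
Qed.

Lemma sum_step n : \sum_(j < n.+1) step Th n j = sin Th ^+ 2.
Proof.
rewrite -(big_mkord xpredT (fun j => step Th n j)) telescope_sumr//.
by rewrite thetan theta0 sin0 expr0n/= subr0.
Qed.

Lemma sum_step_tag n :
  \sum_(j < n.+1) step Th n j * (sin (gtag Th n j) / cos (gtag Th n j)) = alpha Th.
Proof.
under eq_bigr => j _ do rewrite (proj2 (gtagP (ltn_ord j))).
rewrite -(big_mkord xpredT (fun j => alpha (theta Th n j.+1) - alpha (theta Th n j))).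
by rewrite telescope_sumr// thetan theta0 alpha0 subr0.
Qed.

(** If a step vanished, the equation of its tag would give [alpha] equal values at both ends,
    although the derivative 2 sin^2 is positive between them. *)
Lemma step_lt n j : (j < n.+1)%N -> 0 < step Th n j.
Proof.
move=> jn; have := step_ge0 jn; rewrite le_eqVlt => /predU1P[E|//].
have := proj2 (gtagP jn); rewrite -E mul0r => /esym/eqP; rewrite subr_eq0 => /eqP aE.
have [/andP[g1 g2] _] := gtagP jn.
have [c cab] := @MVT _ alpha _ _ _ (thetaS_lt n j Th0) (fun x _ => is_derive_alpha x)
 (continuous_subspaceT (fun x => differentiable_continuous
   (proj1 (derivable1_diffP _ _) (@ex_derive _ _ _ _ _ _ _ (is_derive_alpha x))))).
rewrite aE subrr => /esym/eqP; rewrite mulf_eq0 subr_eq0 (gt_eqF (thetaS_lt n j Th0)) orbF.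
rewrite mulf_eq0 pnatr_eq0/= expf_eq0/= gt_eqF//.
move: cab; rewrite in_itv/= => /andP[c1 c2]; rewrite sin_gt0_pihalf//.
by rewrite (le_lt_trans _ c1) ?theta_ge0 ?(ltW Th0)//= (lt_le_trans c2)// thetaS_pihalf.
Qed.

End gridTh.

Lemma exists_interval (s : nat -> R) (n : nat) (v : R) : s 0%N < v -> v <= s n ->
  exists2 j, (j < n)%N & s j < v <= s j.+1.
Proof.
move=> s0; elim: n => [|n IHn] vn; first by move: s0; rewrite ltNge vn.
have [vsn|snv] := leP v (s n).
  by have [j jn h] := IHn vsn; exists j => //; rewrite ltnS ltnW.
by exists n => //; rewrite snv.
Qed.

End grid.

(** * Contribution of one grid cell *)

Section inner_bounds.
Context {R : realType}.
Variables (m t Th : R).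
Hypotheses (t0 : 0 < t) (Th0 : 0 < Th) (Thpi : Th <= pi / 2).
Implicit Types (n j : nat).

Definition grid_time n j : R := t * sin (theta Th n j) ^+ 2.
Definition tag_time n j : R := t * sin (gtag Th n j) ^+ 2.
Definition tag_left n j : R := t * cos (gtag Th n j) ^+ 2.
(** The value of sqrt(s / (t - s)) at the tag. *)
Definition gtan n j : R := sin (gtag Th n j) / cos (gtag Th n j).

Lemma tag_timeD n j : tag_time n j + tag_left n j = t.
Proof. by rewrite -mulrDr addrC cos2Dsin2 mulr1. Qed.

Lemma tag_leftE n j : tag_left n j = t - tag_time n j.
Proof. by rewrite -[t in RHS](tag_timeD n j) addrC addKr. Qed.

Lemma tag_time_gt0 n j : (j < n.+1)%N -> 0 < tag_time n j.
Proof. by move=> jn; rewrite mulr_gt0// exprn_gt0// sin_gtag_gt0. Qed.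

Lemma tag_left_gt0 n j : (j < n.+1)%N -> 0 < tag_left n j.
Proof. by move=> jn; rewrite mulr_gt0// exprn_gt0// cos_gtag_gt0. Qed.

Lemma gtan_gt0 n j : (j < n.+1)%N -> 0 < gtan n j.
Proof. by move=> jn; rewrite divr_gt0 ?sin_gtag_gt0 ?cos_gtag_gt0. Qed.

Lemma sqrt_tag n j : (j < n.+1)%N ->
  Num.sqrt (tag_time n j) / Num.sqrt (tag_left n j) = gtan n j.
Proof.
move=> jn; have E a : 0 < a -> Num.sqrt (t * a ^+ 2) = Num.sqrt t * a.
  by move=> a0; rewrite sqrtrM ?(ltW t0)// sqrtr_sqr gtr0_norm.
rewrite /tag_time /tag_left !E ?sin_gtag_gt0 ?cos_gtag_gt0// /gtan.
rewrite -mulf_div divff ?mul1r// gt_eqF// sqrtr_gt0//.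
Qed.

Lemma grid_timeSB n j : grid_time n j.+1 - grid_time n j = t * step Th n j.
Proof. by rewrite -mulrBr. Qed.

Lemma grid_time_ge0 n j : 0 <= grid_time n j.
Proof. by rewrite mulr_ge0 ?(ltW t0)// sqr_ge0. Qed.

Lemma grid_time_le n j : grid_time n j <= t.
Proof.
by rewrite ger_pMr// sin2cos2 gerBl sqr_ge0.
Qed.

Lemma grid_timeS_lt n j : (j < n.+1)%N -> grid_time n j < grid_time n j.+1.
Proof. by move=> jn; rewrite -subr_gt0 grid_timeSB mulr_gt0// step_lt. Qed.

Lemma tag_time_itv n j : (j < n.+1)%N ->
  grid_time n j <= tag_time n j <= grid_time n j.+1.
Proof.
move=> jn; have [/andP[/ltW h1 /ltW h2] _] := gtagP Th0 Thpi jn.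
have h0 : 0 <= theta Th n j by rewrite theta_ge0// ltW.
have h3 := thetaS_pihalf Th0 Thpi jn.
by rewrite !ler_wpM2l ?(ltW t0)//; apply: sin_sqr_le => //;
  [exact: le_trans h1|exact: le_trans h3].
Qed.

Lemma grid_mesh n j : (j < n.+1)%N ->
  grid_time n j.+1 - grid_time n j <= t * (2 * Th) * n.+1%:R^-1.
Proof.
move=> jn; rewrite grid_timeSB -mulrA ler_wpM2l ?(ltW t0)//.
by rewrite (le_trans (sin_sqr_lip _))//; [exact/ltW/thetaS_lt|rewrite thetaSB mulrA].
Qed.

Definition off_bound n j (y : R) : R := gauss_bound m t y (gtan n j / Num.sqrt t).

Lemma integral_ftilde_tag n j y : (j < n.+1)%N ->
  (\int[normal_prob 0 (Num.sqrt (tag_time n j))]_a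
     (ftilde m (tag_left n j) (y - m * tag_time n j - a))%:E <= (off_bound n j y)%:E)%E.
Proof.
move=> jn; have := integral_ftilde_le m y (tag_time_gt0 jn) (tag_left_gt0 jn).
by rewrite tag_timeD sqrt_tag.
Qed.

Lemma integral_pos_ftilde_tag n j : (j < n.+1)%N ->
  (\int[normal_prob 0 (Num.sqrt (tag_time n j))]_a
     (ftilde_pos m (tag_left n j) (- (m * tag_time n j) - a))%:E =
   (expR (- (m ^+ 2 * t / 2)) / (2 * pi * t) * gtan n j)%:E)%E.
Proof.
move=> jn; have := integral_pos_ftilde m (tag_time_gt0 jn) (tag_left_gt0 jn).
by rewrite tag_timeD sqrt_tag.
Qed.

Lemma sum_step_gtan n : \sum_(j < n.+1) step Th n j * gtan n j = alpha Th.
Proof. exact: sum_step_tag. Qed.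

Lemma off_bound_ge0 n j y : (j < n.+1)%N -> 0 <= off_bound n j y.
Proof.
move=> jn; rewrite mulr_ge0 ?normal_pdf_ge0// addr_ge0// divr_ge0 ?(ltW t0)//.
by rewrite ltW// gtan_gt0.
Qed.

(** Uniform in [y], so it applies whatever the law of a sum of several jumps. *)
Lemma off_bound_le n j y : t <= 1 -> (j < n.+1)%N ->
  off_bound n j y <= (1 + `|m| + gtan n j) / t.
Proof.
move=> t1 jn; rewrite /off_bound /gauss_bound.
set c := y - m * t; set p := normal_pdf _ _ _.
have p0 : 0 <= p by exact: normal_pdf_ge0.
have h1 : Num.sqrt t * p <= 1 by exact: sqrt_normal_pdf_le1.
have h2 : `|c| * p <= 1 by exact: norm_normal_pdf_le1.
have s0 : 0 < Num.sqrt t by rewrite sqrtr_gt0.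
have s1 : Num.sqrt t <= 1 by rewrite -[leRHS]sqrtr1 ler_wsqrtr.
have yc : `|y| <= `|c| + `|m| * t.
  rewrite (_ : y = c + m * t); last by rewrite /c; ring.
  by rewrite (le_trans (ler_normD _ _))// normrM (gtr0_norm t0).
have yp : `|y| * p <= 1 + `|m|.
  apply: (le_trans (ler_wpM2r p0 yc)); rewrite mulrDl lerD//.
  rewrite -mulrA ler_piMr// -(sqr_sqrtr (ltW t0)) expr2 -mulrA.
  by rewrite (le_trans (ler_wpM2l (ltW s0) h1))// mulr1.
have k0 := ltW (gtan_gt0 jn).
rewrite (_ : p * _ = (`|y| * p + gtan n j * (Num.sqrt t * p)) / t).
  by rewrite ler_wpM2r ?invr_ge0 ?(ltW t0)// lerD// ler_piMr.
rewrite (_ : t^-1 = (Num.sqrt t)^-1 * (Num.sqrt t)^-1); last first.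
  by rewrite -invfM -expr2 sqr_sqrtr ?ltW.
by field; rewrite gt_eqF.
Qed.

Lemma sum_off_bound n y : sin Th ^+ 2 <= 1 -> alpha Th <= pi / 2 ->
  \sum_(j < n.+1) t * step Th n j * off_bound n j y <= gauss_sum m t y.
Proof.
move=> sTh aTh; rewrite /off_bound /gauss_bound /gauss_sum.
set p := normal_pdf _ _ _.
have p0 : 0 <= p by exact: normal_pdf_ge0.
have s0 : 0 < Num.sqrt t by rewrite sqrtr_gt0.
rewrite (eq_bigr (fun j : 'I_n.+1 => p * `|y| * step Th n j +
  p * Num.sqrt t * (step Th n j * gtan n j))); last first.
  move=> j _; have E : t / Num.sqrt t = Num.sqrt t.
    by rewrite -{1}(sqr_sqrtr (ltW t0)) expr2 mulfK ?gt_eqF.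
  rewrite (_ : t * _ * _ = p * `|y| * step Th n j * (t / t) +
    p * (t / Num.sqrt t) * (step Th n j * gtan n j)); last by ring.
  by rewrite divff ?gt_eqF// mulr1 E.
rewrite big_split/= -!mulr_sumr sum_step sum_step_gtan [leRHS]mulrDr lerD//.
  by rewrite ler_piMr// mulr_ge0.
by rewrite [leRHS]mulrA ler_wpM2l// mulr_ge0// ltW.
Qed.

End inner_bounds.

Lemma cvg_within_seq (R : realType) (D : set R) (f : R -> R) (a l : R) (u : R^nat) :
  f s @[s --> within D (nbhs a)] --> l -> (forall n, D (u n)) ->
  u n @[n --> \oo] --> a -> f (u n) @[n --> \oo] --> l.
Proof.
move=> fl Du ua; apply: (cvg_comp u f _ fl) => A /= DA.
have := ua _ DA; rewrite /= /nbhs/=; apply: filterS => n; apply; exact: Du.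
Qed.

Section path_approximation.
Context (R : realType) (T : Type) (W : R -> T -> R) (N : R -> T -> nat)
  (Y : nat -> T -> R) (m x : R).

(** Gathers the almost sure properties, so that the rest of this part is deterministic. *)
Definition regular_path (w : T) : Prop :=
  [/\ W 0 w = 0, {within @nonneg_times R, continuous (fun t => W t w)},
    N 0 w = 0%N,
    (forall s t : R, 0 <= s -> s <= t -> (N s w <= N t w)%N) &
    (forall t : R, 0 <= t -> \forall s \near t^'+, N s w = N t w)].

Let X := jump_diffusion m W N Y.

(** The distance to the level when the continuous part is read at the tag instead of the jump
    time. *)
Definition tag_value (t Th : R) (k n j : nat) (w : T) : R :=
  x - (m * tag_time t Th n j + W (tag_time t Th n j) w + \sum_(i < k) Y i w).

(** The tag and the jump time share a cell of width O(1/n), and [W] is continuous. The sum of jumps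
    needs no approximation, as the count at [tau] is already [N t w]. *)
Lemma tag_approx (t Th : R) (w : T) : regular_path w -> 0 < t ->
  0 < Th -> Th <= pi / 2 -> (0 < N t w)%N ->
  let tau := last_jump_time N t w in
  tau <= t * sin Th ^+ 2 ->
  exists jn : nat -> nat, [/\ forall n, (jn n < n.+1)%N,
    forall n, grid_time t Th n (jn n) < tau <= grid_time t Th n (jn n).+1,
    tag_left t Th n (jn n) @[n --> \oo] --> t - tau &
    tag_value t Th (N t w) n (jn n) w @[n --> \oo] --> x - X tau w].
Proof.
move=> [W0 Wc N0 Nnd Nrc] t0 Th0 Thpi Nt tau tauTh.
have [tau0 taut Ntau hlt] := last_jump_time_spec N0 Nnd Nrc (ltW t0) Nt.
have : forall n, exists j, (j < n.+1)%N /\ grid_time t Th n j < tau <= grid_time t Th n j.+1.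
  move=> n; have [||j jn h] := @exists_interval _ (grid_time t Th n) n.+1 tau.
  - by rewrite /grid_time theta0 sin0 expr0n/= mulr0.
  - by rewrite /grid_time thetan.
  - by exists j.
move=> /choice[jn jnP]; have jnn n := proj1 (jnP n); have jni n := proj2 (jnP n).
have cs : tag_time t Th n (jn n) @[n --> \oo] --> tau.
  apply/cvgrPdist_le => e e0.
  have c0 : t * (2 * Th) * n.+1%:R^-1 @[n --> \oo] --> t * (2 * Th) * 0.
    by apply: cvgM; [exact: cvg_cst|exact: cvg_harmonic].
  rewrite mulr0 in c0; near=> n.
  apply: (@le_trans _ _ (t * (2 * Th) * n.+1%:R^-1)); last first.
    by near: n; move/cvgr_le : c0; exact.
  apply: le_trans (grid_mesh t0 Th0 (jnn n)).
  have /andP[h1 h2] := jni n; have /andP[h3 h4] := tag_time_itv t0 Th0 Thpi (jnn n).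
  by rewrite ler_norml; apply/andP; split; lra.
exists jn; split => //.
- under eq_fun do rewrite tag_leftE.
  by apply: cvgB => //; exact: cvg_cst.
- apply: cvgB; first exact: cvg_cst.
  rewrite /X /jump_diffusion Ntau; apply: cvgD; last exact: cvg_cst.
  apply: cvgD; first by apply: cvgM => //; exact: cvg_cst.
  apply: (@cvg_within_seq _ (@nonneg_times R) (fun s => W s w) tau) => //.
    by move/subspace_continuousP : Wc; apply; exact: ltW.
  by move=> n; rewrite /nonneg_times/= ltW// tag_time_gt0.
Unshelve. all: by end_near. Qed.

(** Before the jump, the margin between x/2 and [x] lets continuity carry the bound from rational to
    all times. After it, right continuity keeps the path below [x] on a further interval, which
    makes the inequality between the two times strict. *)
Lemma hitting_after_jump (t : R) (w : T) : regular_path w -> 0 < t -> N t w = 1%N ->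
  (forall q : rat, (0 : R) <= ratr q <= t -> m * ratr q + W (ratr q) w <= x / 2) ->
  0 < x -> let tau := last_jump_time N t w in
  X tau w < x -> (tau%:E < hitting_time X x w)%E.
Proof.
move=> [W0 Wc N0 Nnd Nrc] t0 Nt small x0 tau Xtau.
have Nt0 : (0 < N t w)%N by rewrite Nt.
have [tau0 taut Ntau hlt] := last_jump_time_spec N0 Nnd Nrc (ltW t0) Nt0.
rewrite -/tau in tau0 taut Ntau hlt.
have Wc' (s : R) : 0 <= s -> m * r + W r w @[r --> within (@nonneg_times R) (nbhs s)] --> m * s + W s w.
  move=> s0; apply: cvgD; last by move/subspace_continuousP : Wc; exact.
  by apply: cvgM; [exact: cvg_cst|exact: cvg_within].
have below (s : R) : 0 <= s -> s < tau -> X s w < x.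
  move=> s0 stau; have Ns : N s w = 0%N.
    by have := hlt s s0 stau; rewrite Nt; case: (N s w).
  rewrite /X /jump_diffusion Ns big_ord0 addr0.
  rewrite ltNge; apply/negP => xs.
  have := Wc' s s0 => /cvgrPdist_lt /(_ (x / 2) (divr_gt0 x0 _)) [//|e /= e0 he].
  have se : s < Num.min (s + e) tau by rewrite lt_min ltrDl e0 stau.
  have [q /= ] := rat_in_itvoo se; rewrite in_itv/= => /andP[sq].
  rewrite lt_min => /andP[qe qtau].
  have q0 : (0 : R) <= ratr q by rewrite (le_trans s0)// ltW.
  have := small q; rewrite q0 (le_trans (ltW qtau) taut) => /(_ isT) hq.
  have := he (ratr q); rewrite /ball_/= distrC ger0_norm ?subr_ge0 ?(ltW sq)// ltrBlDl.
  by move=> /(_ qe q0); rewrite ltr_norml => /andP[_]; lra.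
have [e /= e0 he] := Nrc tau (ltW tau0).
have := Wc' tau (ltW tau0) => /cvgrPdist_lt.
have d0 : 0 < x - X tau w by rewrite subr_gt0.
move=> /(_ _ d0) [e' /= e'0 he'].
apply: (@hitting_time_gt _ _ _ _ _ tau (tau + Num.min e e')).
  by rewrite ltrDl lt_min e0.
move=> q q0; rewrite -ltrBlDl lt_min => /andP[qe qe'].
have [qtau|] := ltP q tau; first exact: below.
rewrite le_eqVlt => /predU1P[<-//|tauq].
have Nq : N q w = N tau w.
  by apply: he => //=; rewrite distrC ger0_norm ?subr_ge0// ltW.
have := he' q; rewrite /ball_/= distrC ger0_norm ?subr_ge0 ?(ltW tauq)// => /(_ qe' q0).
rewrite ltr_norml => /andP[+ _]; rewrite /X /jump_diffusion Nq.
by set S := \sum_(i < _) _; lra.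
Qed.

End path_approximation.

Lemma integral_cst_probability d (T : measurableType d) (R : realType)
  (P : probability T R) (c : R) : (\int[P]_w c%:E = c%:E)%E.
Proof. by have := expectation_cst P c; rewrite unlock. Qed.

(** * Lower limits and nonnegative series in the extended reals *)

Section limn_einf_extra.
Context {R : realType}.
Local Open Scope ereal_scope.

Lemma le_limn_einf (u v : (\bar R)^nat) : (forall n, u n <= v n) ->
  limn_einf u <= limn_einf v.
Proof.
move=> uv; rewrite !limn_einf_lim; apply: lee_lim; [exact: is_cvg_einfs|exact: is_cvg_einfs|].
apply: nearW => n; apply: le_ereal_inf_tmp => _ [k /= nk <-].
by apply: le_trans (uv k); apply: ereal_inf_lbound; exists k.
Qed.

Lemma cvg_le_limn_einf (u v : (\bar R)^nat) l : u @ \oo --> l ->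
  (forall n, u n <= v n) -> l <= limn_einf v.
Proof.
by move=> ul uv; rewrite -(cvg_limn_einf_sup ul).1; exact: le_limn_einf.
Qed.

Lemma limn_einf_le (u : (\bar R)^nat) (c : \bar R) : (forall n, u n <= c) ->
  limn_einf u <= c.
Proof.
move=> uc; have [<- _] := cvg_limn_einf_sup (@cvg_cst _ c nat \oo _).
exact: le_limn_einf.
Qed.

Lemma lee_nneseries_term (u : (\bar R)^nat) k : (forall n, 0 <= u n) ->
  u k <= \sum_(n <oo) u n.
Proof.
move=> u0; apply: le_trans (nneseries_lim_ge k.+1 (fun n _ _ => u0 n)).
by rewrite big_nat_recr//= leeDr// sume_ge0.
Qed.

Lemma lee_sum_term (n : nat) (u : (\bar R)^nat) j : (forall i, 0 <= u i) ->
  (j < n)%N -> u j <= \sum_(i < n) u i.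
Proof.
by move=> u0 jn; rewrite (bigD1 (Ordinal jn))//= leeDl//; apply: sume_ge0 => i _.
Qed.

End limn_einf_extra.

(** * Bounds on the expectation at a fixed time *)

Section last_jump_expectation.
Context (R : realType) (d : measure_display) (T : measurableType d)
  (P : probability T R) (m lambda : R) (W : R -> {RV P >-> R})
  (N : R -> {RV P >-> nat}) (Y : nat -> {RV P >-> R}) (x : R).
Hypotheses (lambda_gt0 : 0 < lambda) (brownianW : brownian_motion W)
  (poissonN : poisson_process lambda N)
  (indepWNY : independent_processes W N Y) (x_gt0 : 0 < x).

Let X : R -> T -> R := jump_diffusion m W N Y.
Let TN : R -> T -> R := last_jump_time N.
Let tau : T -> \bar R := hitting_time X x.

Definition integrand (t : R) (w : T) : R :=
  \1_[set w' | ((TN t w')%:E < tau w')%E] w *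
  ftilde m (t - TN t w) (x - X (TN t w) w).

Lemma integrand_ge0 t w : 0 <= integrand t w.
Proof. by rewrite mulr_ge0// ftilde_ge0. Qed.

Lemma ae_regular_path : {ae P, forall w, regular_path W N w}.
Proof.
have [hW _ _] := brownianW; have [hN _ _] := poissonN.
by apply: filterS2 hW hN => w [W0 Wc] [N0 Nnd Nrc].
Qed.

Local Open Scope ereal_scope.

Lemma measurable_term (h : R * R -> R) (s : R) (k : nat) (B : set T) :
  measurable_fun setT h -> measurable B ->
  measurable_fun setT (fun w => (h (W s w, partial_sum Y k w))%:E * (\1_B w)%:E).
Proof.
move=> mh mB; apply: emeasurable_funM; apply/measurable_EFinP.
  by apply: (measurableT_comp mh); exact: measurable_fun_pair.
exact: measurable_indic.
Qed.

Definition pos_kernel (t Th : R) n j (z : R * R) : R :=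
  ftilde_pos m (tag_left t Th n j) (x - (m * tag_time t Th n j + z.1 + z.2))%R.

Definition abs_kernel (t Th : R) n j (z : R * R) : R :=
  ftilde m (tag_left t Th n j) (x - (m * tag_time t Th n j + z.1 + z.2))%R.

Let measurable_arg (t Th : R) n j :
  measurable_fun setT (fun z : R * R => x - (m * tag_time t Th n j + z.1 + z.2))%R.
Proof.
apply: measurable_funB => //; apply: measurable_funD; last exact: measurable_snd.
by apply: measurable_funD => //; exact: measurable_fst.
Qed.

Lemma measurable_pos_kernel t Th n j : measurable_fun setT (pos_kernel t Th n j).
Proof. by apply: measurableT_comp => //; exact: measurable_ftilde_pos. Qed.

Lemma measurable_abs_kernel t Th n j : measurable_fun setT (abs_kernel t Th n j).
Proof. by apply: measurableT_comp => //; exact: measurable_ftilde. Qed.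

Definition jump_cell (t Th : R) n j k : set T :=
  last_jump_in N (grid_time t Th n j) (grid_time t Th n j.+1) t k.

Lemma measurable_jump_cell t Th n j k : measurable (jump_cell t Th n j k).
Proof. exact: measurable_last_jump_in. Qed.

Lemma sigma_generated_jump_cell (t Th : R) n j k : (0 < t)%R ->
  sigma_generated (@nonneg_times R) (fun t => N t : T -> nat) (jump_cell t Th n j k).
Proof. by move=> t0; apply: sigma_generated_last_jump_in; rewrite ?grid_time_ge0// ltW. Qed.

Definition pos_term t Th n j (w : T) : \bar R :=
  (pos_kernel t Th n j (W (tag_time t Th n j) w, partial_sum Y 1 w))%:E *
  (\1_(jump_cell t Th n j 1) w)%:E.

Definition abs_term t Th n j k (w : T) : \bar R :=
  (abs_kernel t Th n j (W (tag_time t Th n j) w, partial_sum Y k w))%:E *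
  (\1_(jump_cell t Th n j k) w)%:E.

Lemma pos_term_ge0 t Th n j w : 0 <= pos_term t Th n j w.
Proof. by rewrite mule_ge0// lee_fin// ftilde_pos_ge0. Qed.

Lemma abs_term_ge0 t Th n j k w : 0 <= abs_term t Th n j k w.
Proof. by rewrite mule_ge0// lee_fin// ftilde_ge0. Qed.

Lemma measurable_pos_term t Th n j : measurable_fun setT (pos_term t Th n j).
Proof. exact: measurable_term (measurable_pos_kernel _ _ _ _) (measurable_jump_cell _ _ _ _ _). Qed.

Lemma measurable_abs_term t Th n j k : measurable_fun setT (abs_term t Th n j k).
Proof. exact: measurable_term (measurable_abs_kernel _ _ _ _) (measurable_jump_cell _ _ _ _ _). Qed.

(* At most one cell contributes at [w].  If there is a single jump then
   [tau > T] forces [X_T < x], hence the kernel restricted to the half line; with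
   more jumps the crude kernel is enough. *)
Definition upper_approx t n (w : T) : \bar R :=
  (ftilde m t x)%:E +
  \sum_(j < n.+1) (pos_term t (pi / 2) n j w + \sum_(k <oo) abs_term t (pi / 2) n j k.+2 w).

Let cell_ge0 t n j w :
  0 <= pos_term t (pi / 2) n j w + \sum_(k <oo) abs_term t (pi / 2) n j k.+2 w.
Proof.
rewrite adde_ge0 ?pos_term_ge0//; apply: nneseries_ge0 => k _ _.
exact: abs_term_ge0.
Qed.

Lemma upper_approx_ge0 t n w : 0 <= upper_approx t n w.
Proof.
rewrite adde_ge0// ?lee_fin ?ftilde_ge0//; apply: sume_ge0 => j _.
exact: cell_ge0.
Qed.

Let measurable_cell t n j : measurable_fun setT (fun w =>
  pos_term t (pi / 2) n j w + \sum_(k <oo) abs_term t (pi / 2) n j k.+2 w).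
Proof.
apply: emeasurable_funD; first exact: measurable_pos_term.
apply: ge0_emeasurable_sum => [k w _ _|k _]; first exact: abs_term_ge0.
exact: measurable_abs_term.
Qed.

Lemma measurable_upper_approx t n : measurable_fun setT (upper_approx t n).
Proof.
apply: emeasurable_funD => //.
by apply: emeasurable_sum => j; exact: measurable_cell.
Qed.

Lemma upper_approx_ge_pos t n j w : (j < n.+1)%N -> jump_cell t (pi / 2) n j 1 w ->
  (ftilde_pos m (tag_left t (pi / 2) n j) (tag_value W Y m x t (pi / 2) 1 n j w))%:E
    <= upper_approx t n w.
Proof.
move=> jn wJ; apply: (@le_trans _ _ (pos_term t (pi / 2) n j w)).
  by rewrite /pos_term indicE mem_set// mule1.
rewrite /upper_approx; apply: (@le_trans _ _ (\sum_(j < n.+1) (pos_term t (pi / 2) n j w +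
    \sum_(k <oo) abs_term t (pi / 2) n j k.+2 w))); last first.
  by rewrite leeDr// lee_fin ftilde_ge0.
apply: le_trans (lee_sum_term (fun i => cell_ge0 t n i w) jn).
rewrite leeDl//; apply: nneseries_ge0 => k _ _; exact: abs_term_ge0.
Qed.

Lemma upper_approx_ge_abs t n j k w : (j < n.+1)%N -> jump_cell t (pi / 2) n j k.+2 w ->
  (ftilde m (tag_left t (pi / 2) n j) (tag_value W Y m x t (pi / 2) k.+2 n j w))%:E
    <= upper_approx t n w.
Proof.
move=> jn wJ; apply: (@le_trans _ _ (abs_term t (pi / 2) n j k.+2 w)).
  by rewrite /abs_term indicE mem_set// mule1.
rewrite /upper_approx; apply: (@le_trans _ _ (\sum_(j < n.+1) (pos_term t (pi / 2) n j w +
    \sum_(k <oo) abs_term t (pi / 2) n j k.+2 w))); last first.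
  by rewrite leeDr// lee_fin ftilde_ge0.
apply: le_trans (lee_sum_term (fun i => cell_ge0 t n i w) jn).
apply: (@le_trans _ _ (\sum_(k <oo) abs_term t (pi / 2) n j k.+2 w)).
  by apply: (lee_nneseries_term (u := fun k => abs_term t (pi / 2) n j k.+2 w)) => i; exact: abs_term_ge0.
by rewrite leeDr// pos_term_ge0.
Qed.

Let pihalf0 : (0 < pi / 2 :> R)%R. Proof. by rewrite divr_gt0 ?pi_gt0. Qed.

Lemma jump_cellP (t Th : R) n j w : regular_path W N w -> (0 < t)%R ->
  (0 < Th)%R -> (Th <= pi / 2)%R -> (j < n.+1)%N -> (0 < N t w)%N ->
  forall k, jump_cell t Th n j k w <->
  N t w = k /\ (grid_time t Th n j < TN t w <= grid_time t Th n j.+1)%R.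
Proof.
move=> [W0 Wc N0 Nnd Nrc] t0 Th0 Thpi jn Nt k.
have h := @last_jump_inP _ _ N w N0 Nnd Nrc (grid_time t Th n j)
  (grid_time t Th n j.+1) t k (grid_time_ge0 Th t0 n j)
  (ltW (grid_timeS_lt t0 Th0 Thpi jn)) (grid_time_le Th t0 n j.+1) Nt.
split.
- by move=> [[/= h1 h2] h3]; apply/h.
- by move=> /h [h1 h2 h3]; split => //; split.
Qed.

Lemma integrand_le_upper_approx (t : R) w : regular_path W N w -> (0 < t)%R ->
  (integrand t w)%:E <= limn_einf (upper_approx t ^~ w).
Proof.
move=> rw t0; have [W0 Wc N0 Nnd Nrc] := rw.
have [Nt|Nt] := posnP (N t w).
  apply: (@cvg_le_limn_einf _ (cst (integrand t w)%:E)); first exact: cvg_cst.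
  move=> n /=; apply: (@le_trans _ _ (ftilde m t x)%:E); last first.
    by rewrite leeDl// sume_ge0// => j _; exact: cell_ge0.
  rewrite lee_fin /integrand /TN (@last_jump_time_no_jump R T N w t Nt) subr0.
  rewrite /X /jump_diffusion mulr0 W0 N0 big_ord0 !addr0 subr0.
  by rewrite indicE ler_piMl ?ftilde_ge0// lern1 leq_b1.
have [tau0 taut Ntau hlt] := @last_jump_time_spec R T N w N0 Nnd Nrc t (ltW t0) Nt.
have tauS : (TN t w <= t * sin (pi / 2) ^+ 2)%R by rewrite sin_pihalf expr1n mulr1.
have [jn [jnn jni cu cz]] := @tag_approx R T W N Y m x t (pi / 2)%R w rw t0 pihalf0 (lexx _) Nt tauS.
have inJ n : jump_cell t (pi / 2) n (jn n) (N t w) w.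
  by apply/jump_cellP => //; split.
(* A jump exactly at [t] leaves no remaining time, and [ftilde] is 0 there. *)
move: taut; rewrite le_eqVlt => /predU1P[taut|taut].
  rewrite /integrand /TN taut subrr /ftilde ltxx mulr0.
  apply: (@cvg_le_limn_einf _ (cst 0)); first exact: cvg_cst.
  by move=> n; exact: upper_approx_ge0.
have ttau0 : (0 < t - TN t w)%R by rewrite subr_gt0.
have ul0 n : (0 < tag_left t (pi / 2) n (jn n))%R.
  exact: tag_left_gt0.
case ENt : (N t w) Nt inJ cz => [//|[|k]] _ inJ cz.
- apply: (@le_trans _ _ (ftilde_pos m (t - TN t w) (x - X (TN t w) w))%:E).
    rewrite lee_fin /integrand indicE; case: (boolP (_ \in _)); last first.
      by rewrite mul0r ftilde_pos_ge0.
    rewrite inE/= => /(lt_hitting_time (ltW tau0)) Xx.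
    by rewrite mul1r /ftilde_pos subr_gt0 Xx.
  apply: (@cvg_le_limn_einf _ (fun n => (ftilde_pos m (tag_left t (pi / 2) n (jn n))
     (tag_value W Y m x t (pi / 2) 1 n (jn n) w))%:E)); last first.
    by move=> n; apply: upper_approx_ge_pos.
  apply: cvg_EFin; first exact: nearW.
  exact: cvg_ftilde_pos_cont cu cz.
- apply: (@le_trans _ _ (ftilde m (t - TN t w) (x - X (TN t w) w))%:E).
    by rewrite lee_fin /integrand indicE ler_piMl ?ftilde_ge0// lern1 leq_b1.
  apply: (@cvg_le_limn_einf _ (fun n => (ftilde m (tag_left t (pi / 2) n (jn n))
     (tag_value W Y m x t (pi / 2) k.+2 n (jn n) w))%:E)); last first.
    by move=> n; apply: upper_approx_ge_abs.
  apply: cvg_EFin; first exact: nearW.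
  exact: cvg_ftilde_cont cu cz.
Qed.

(** A majorant given the jump size: at [y = x] the exact half-line value stripped of e^{-m^2 t/2} <=
    1, elsewhere the bound for the full kernel. *)
Definition on_diagonal (t : R) n j (y : R) : R :=
  if y == x then ((2 * pi * t)^-1 * gtan (pi / 2) n j)%R
  else off_bound m t (pi / 2) n j (x - y).

Let pihalf_le : (pi / 2 <= pi / 2 :> R)%R := lexx _.

Lemma on_diagonal_ge0 t n j y : (0 < t)%R -> (j < n.+1)%N -> (0 <= on_diagonal t n j y)%R.
Proof.
move=> t0 jn; rewrite /on_diagonal; case: ifP => _; last exact: off_bound_ge0.
apply: mulr_ge0; last by rewrite ltW// gtan_gt0.
by rewrite invr_ge0 !mulr_ge0 ?pi_ge0 ?(ltW t0).
Qed.

Let measurable_if_eq (c : R) (f : R -> R) : measurable_fun setT f ->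
  measurable_fun setT (fun y : R => if y == x then c else f y).
Proof.
move=> mf; apply: measurable_fun_if => //; first exact: measurable_fun_eqr.
exact: measurable_funTS.
Qed.

Lemma measurable_on_diagonal t n j : measurable_fun setT (on_diagonal t n j).
Proof.
apply: measurable_if_eq; apply: measurable_funM.
  apply: measurableT_comp; first exact: measurable_normal_pdf.
  by apply: measurable_funB => //; exact: measurable_funB.
apply: measurable_funD => //; apply: measurable_funM => //.
by apply: measurableT_comp => //; exact: measurable_funB.
Qed.

Lemma integral_abs_kernel_le t n j y : (0 < t)%R -> (j < n.+1)%N ->
  \int[normal_prob 0 (Num.sqrt (tag_time t (pi / 2) n j))]_a
    (abs_kernel t (pi / 2) n j (a, y))%:E <= (off_bound m t (pi / 2) n j (x - y))%:E.
Proof.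
move=> t0 jn; apply: le_trans (integral_ftilde_tag m t0 pihalf0 pihalf_le (x - y) jn).
rewrite le_eqVlt; apply/orP; left; apply/eqP.
by apply: eq_integral => a _; rewrite /abs_kernel/=; congr (ftilde _ _ _)%:E; ring.
Qed.

Lemma integral_pos_kernel_diag t Th n j : (0 < t)%R -> (0 < Th)%R -> (Th <= pi / 2)%R ->
  (j < n.+1)%N ->
  \int[normal_prob 0 (Num.sqrt (tag_time t Th n j))]_a (pos_kernel t Th n j (a, x))%:E =
  (expR (- (m ^+ 2 * t / 2)) / (2 * pi * t) * gtan Th n j)%:E.
Proof.
move=> t0 Th0 Thpi jn; rewrite -integral_pos_ftilde_tag//.
by apply: eq_integral => a _; rewrite /pos_kernel/=; congr (ftilde_pos _ _ _)%:E; ring.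
Qed.

Lemma integral_pos_kernel_le t n j y : (0 < t)%R -> (j < n.+1)%N ->
  \int[normal_prob 0 (Num.sqrt (tag_time t (pi / 2) n j))]_a
    (pos_kernel t (pi / 2) n j (a, y))%:E <= (on_diagonal t n j y)%:E.
Proof.
move=> t0 jn; rewrite /on_diagonal; case: eqP => [->|_].
  rewrite integral_pos_kernel_diag// lee_fin ler_wpM2r//.
    by rewrite ltW// gtan_gt0.
  rewrite ler_piMl ?invr_ge0 ?(mulr_ge0 (mulr_ge0 _ (pi_ge0 _)) (ltW t0))//.
  rewrite -expR0 ler_expR oppr_le0 divr_ge0// mulr_ge0 ?sqr_ge0//.
  exact: ltW.
apply: le_trans (integral_abs_kernel_le _ t0 jn).
apply: ae_le_integral_measurable_r.
- by move=> a; rewrite lee_fin ftilde_pos_ge0.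
- by move=> a; rewrite lee_fin ftilde_ge0.
- apply/measurable_EFinP; apply: (measurableT_comp (measurable_abs_kernel _ _ _ _)).
  exact: measurable_fun_pair.
- by apply: aeW => a; rewrite lee_fin ftilde_pos_le.
Qed.

Let step_pi_ge0 n j : (j < n.+1)%N -> (0 <= step (pi / 2) n j :> R)%R.
Proof. by move=> jn; exact: step_ge0. Qed.

Lemma integral_pos_term_le t n j : (0 < t)%R -> (j < n.+1)%N ->
  \int[P]_w pos_term t (pi / 2) n j w <=
  (lambda * (t * step (pi / 2) n j))%:E *
  \int[distribution P (partial_sum Y 1)]_y (on_diagonal t n j y)%:E.
Proof.
move=> t0 jn.
have -> : \int[P]_w pos_term t (pi / 2) n j w = P (jump_cell t (pi / 2) n j 1) *
    \int[distribution P (partial_sum Y 1)]_y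
     \int[normal_prob 0 (Num.sqrt (tag_time t (pi / 2) n j))]_a
       (pos_kernel t (pi / 2) n j (a, y))%:E.
  apply: (integral_indep brownianW indepWNY) => //.
  - exact: tag_time_gt0.
  - exact: measurable_jump_cell.
  - exact: sigma_generated_jump_cell.
  - exact: measurable_pos_kernel.
  - by move=> z; exact: ftilde_pos_ge0.
apply: lee_pmul => //.
- by apply: integral_ge0 => y _; apply: integral_ge0 => a _; rewrite lee_fin ftilde_pos_ge0.
- rewrite -grid_timeSB; apply: (P_last_jump_in1_le lambda_gt0 poissonN).
    exact: grid_time_ge0.
  by apply: ltW; exact: grid_timeS_lt.
- apply: ae_le_integral_measurable_r.
  + by move=> y; apply: integral_ge0 => a _; rewrite lee_fin ftilde_pos_ge0.
  + by move=> y; rewrite lee_fin on_diagonal_ge0.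
  + by apply/measurable_EFinP; exact: measurable_on_diagonal.
  + by apply: aeW => y; exact: integral_pos_kernel_le.
Qed.

Lemma integral_abs_term_le t n j k : (0 < t)%R -> (t <= 1)%R -> (j < n.+1)%N ->
  \int[P]_w abs_term t (pi / 2) n j k w <=
  P (jump_cell t (pi / 2) n j k) * ((1 + `|m| + gtan (pi / 2) n j) / t)%:E.
Proof.
move=> t0 t1 jn.
have -> : \int[P]_w abs_term t (pi / 2) n j k w = P (jump_cell t (pi / 2) n j k) *
    \int[distribution P (partial_sum Y k)]_y
     \int[normal_prob 0 (Num.sqrt (tag_time t (pi / 2) n j))]_a
       (abs_kernel t (pi / 2) n j (a, y))%:E.
  apply: (integral_indep brownianW indepWNY) => //.
  - exact: tag_time_gt0.
  - exact: measurable_jump_cell.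
  - exact: sigma_generated_jump_cell.
  - exact: measurable_abs_kernel.
  - by move=> z; exact: ftilde_ge0.
apply: lee_pmul => //.
  by apply: integral_ge0 => y _; apply: integral_ge0 => a _; rewrite lee_fin ftilde_ge0.
have q0 : (0 <= (1 + `|m| + gtan (pi / 2) n j) / t)%R.
  by rewrite divr_ge0 ?(ltW t0)// !addr_ge0// ltW// gtan_gt0.
apply: (@le_trans _ _ (\int[distribution P (partial_sum Y k)]_y
   (cst ((1 + `|m| + gtan (pi / 2) n j) / t)%:E y))).
  apply: ae_le_integral_measurable_r => //.
  + by move=> y; apply: integral_ge0 => a _; rewrite lee_fin ftilde_ge0.
  + apply: aeW => y; apply: (le_trans (integral_abs_kernel_le y t0 jn)).
    by rewrite lee_fin off_bound_le.
by rewrite integral_cst_probability.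
Qed.

(** 1/4 is [alpha (pi / 2)] divided by 2 pi; the factor t of the cell widths has cancelled the 1/t
    of [on_diagonal]. *)
Definition diag_limit (t y : R) : R :=
  (if y == x then 1 / 4 else gauss_sum m t (x - y))%R.

Lemma diag_limit_ge0 t y : (0 <= diag_limit t y)%R.
Proof. by rewrite /diag_limit; case: ifP => // _; exact: gauss_sum_ge0. Qed.

Lemma measurable_diag_limit t : measurable_fun setT (diag_limit t).
Proof.
apply: measurable_if_eq; apply: measurableT_comp; first exact: measurable_gauss_sum.
exact: measurable_funB.
Qed.

Lemma sum_on_diagonal t n y : (0 < t)%R ->
  (\sum_(j < n.+1) lambda * (t * step (pi / 2) n j) * on_diagonal t n j y <=
   lambda * diag_limit t y)%R.
Proof.
move=> t0; under eq_bigr do rewrite -mulrA.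
rewrite -mulr_sumr ler_wpM2l ?(ltW lambda_gt0)// /diag_limit /on_diagonal.
case: eqP => _; last first.
  by apply: sum_off_bound => //; rewrite ?sin_pihalf ?expr1n ?alpha_pihalf.
have p0 : (0 < pi :> R)%R by exact: pi_gt0.
rewrite (eq_bigr (fun j : 'I_n.+1 => (2 * pi)^-1 * (step (pi / 2) n j * gtan (pi / 2) n j)))%R.
  rewrite -mulr_sumr sum_step_gtan// alpha_pihalf.
  rewrite le_eqVlt; apply/orP; left; apply/eqP.
  by move: (pi) p0 => p p0; field; rewrite gt_eqF.
move=> j _; move: (pi) p0 (gtan _ _ _) (step _ _ _) => p p0 g s.
by field; rewrite !gt_eqF.
Qed.

(** The bound is free of [n] because the tagged sums telescope exactly, so it survives the lower
    limit in Fatou's lemma unchanged. *)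
Lemma integral_upper_approx_le t n : (0 < t)%R -> (t <= 1)%R ->
  \int[P]_w upper_approx t n w <=
  (ftilde m t x)%:E +
  (\int[distribution P (partial_sum Y 1)]_y (lambda * diag_limit t y)%:E +
   (lambda ^+ 2 * t * (3 + `|m|))%:E).
Proof.
move=> t0 t1.
have mpt j := measurable_pos_term t (pi / 2) n j.
have mabs j k := measurable_abs_term t (pi / 2) n j k.
have sumabs0 j w : 0 <= \sum_(k <oo) abs_term t (pi / 2) n j k.+2 w.
  by apply: nneseries_ge0 => k _ _; exact: abs_term_ge0.
have msum j : measurable_fun setT (fun w => \sum_(k <oo) abs_term t (pi / 2) n j k.+2 w).
  by apply: ge0_emeasurable_sum => // k w _ _; exact: abs_term_ge0.
rewrite ge0_integralD//; last 3 first.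
- by move=> w _; rewrite lee_fin ftilde_ge0.
- by move=> w _; apply: sume_ge0 => j _; exact: cell_ge0.
- by apply: emeasurable_sum => j; exact: measurable_cell.
rewrite integral_cst_probability leeD2l//.
rewrite ge0_integral_sum//.
rewrite (eq_bigr (fun j : 'I_n.+1 => \int[P]_w pos_term t (pi / 2) n j w +
   \int[P]_w \sum_(k <oo) abs_term t (pi / 2) n j k.+2 w)); last first.
  by move=> j _; rewrite ge0_integralD// => w _; exact: pos_term_ge0.
rewrite big_split/=; apply: leeD.
- apply: (@le_trans _ _ (\sum_(j < n.+1) \int[distribution P (partial_sum Y 1)]_y
    (lambda * (t * step (pi / 2) n j) * on_diagonal t n j y)%:E)).
    apply: lee_sum => j _; apply: (le_trans (integral_pos_term_le t0 (ltn_ord j))).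
    have c0 : (0 <= lambda * (t * step (pi / 2) n j))%R.
      by rewrite !mulr_ge0 ?(ltW lambda_gt0) ?(ltW t0) ?step_pi_ge0.
    rewrite le_eqVlt; apply/orP; left; apply/eqP.
    under [RHS]eq_integral do rewrite EFinM.
    apply/esym; apply: ge0_integralZl_EFin => //.
      by move=> y _; rewrite lee_fin on_diagonal_ge0.
    by apply/measurable_EFinP; exact: measurable_on_diagonal.
  rewrite -ge0_integral_sum//; last 2 first.
  + move=> j; apply/measurable_EFinP; apply: measurable_funM => //.
    exact: measurable_on_diagonal.
  + move=> j y _; rewrite lee_fin mulr_ge0 ?on_diagonal_ge0//.
    by rewrite !mulr_ge0 ?(ltW lambda_gt0) ?(ltW t0) ?step_pi_ge0.
  apply: ae_le_integral_measurable_r.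
  + move=> y; apply: sume_ge0 => j _; rewrite lee_fin mulr_ge0 ?on_diagonal_ge0//.
    by rewrite !mulr_ge0 ?(ltW lambda_gt0) ?(ltW t0) ?step_pi_ge0.
  + by move=> y; rewrite lee_fin mulr_ge0 ?diag_limit_ge0 ?ltW.
  + apply/measurable_EFinP; apply: measurable_funM => //.
    exact: measurable_diag_limit.
  + by apply: aeW => y; rewrite sumEFin lee_fin; exact: sum_on_diagonal.
(* Two or more jumps: a probability of at most lambda^2 t times the cell width t * step, against a
   kernel bound in 1/t. The sum over cells leaves lambda^2 t (1 + |m| + pi/2). *)
- apply: (@le_trans _ _ (\sum_(j < n.+1)
    (lambda ^+ 2 * t * (step (pi / 2) n j * (1 + `|m| + gtan (pi / 2) n j)))%:E)).
    apply: lee_sum => j _; have jn := ltn_ord j.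
    rewrite integral_nneseries//; last by move=> k w _; exact: abs_term_ge0.
    pose q := ((1 + `|m| + gtan (pi / 2) n j) / t)%R.
    have q0 : (0 <= q)%R.
      by rewrite divr_ge0 ?(ltW t0)// !addr_ge0// ltW// gtan_gt0.
    apply: (@le_trans _ _ (\sum_(k <oo) (q%:E * P (jump_cell t (pi / 2) n j k.+2)))).
      apply: lee_nneseries => [k _ _|k _]; first by apply: integral_ge0 => w _; exact: abs_term_ge0.
      by rewrite muleC; exact: integral_abs_term_le.
    rewrite nneseriesZl; last by move=> k _; exact: measure_ge0.
    have := P_last_jump_in_ge2_le lambda_gt0 poissonN t (grid_time_ge0 (pi / 2) t0 n j)
      (ltW (grid_timeS_lt t0 pihalf0 pihalf_le jn)).
    move=> /(lee_wpmul2l (_ : 0 <= q%:E)) => /(_ _)/le_trans; apply; first by rewrite lee_fin.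
    rewrite -EFinM lee_fin grid_timeSB.
    have := grid_time_le (pi / 2) t0 n j.+1.
    have s0 := step_pi_ge0 jn.
    move=> gt; apply: (@le_trans _ _ (q * (lambda ^+ 2 * t * (t * step (pi / 2) n j))))%R.
      rewrite ler_wpM2l// ler_wpM2r ?mulr_ge0 ?(ltW t0)// ler_wpM2l// sqr_ge0//.
    by rewrite /q le_eqVlt; apply/orP; left; apply/eqP; field; rewrite gt_eqF.
  rewrite sumEFin lee_fin -mulr_sumr ler_wpM2l ?mulr_ge0 ?(ltW lambda_gt0) ?(ltW t0)//.
  under eq_bigr do rewrite mulrDr.
  rewrite big_split/= sum_step_gtan// -mulr_suml sum_step alpha_pihalf sin_pihalf expr1n mul1r.
  by have := @pihalf_lt2 R; lra.
Qed.

Lemma integral_integrand_le t : (0 < t)%R -> (t <= 1)%R ->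
  \int[P]_w (integrand t w)%:E <=
  (ftilde m t x)%:E +
  (\int[distribution P (partial_sum Y 1)]_y (lambda * diag_limit t y)%:E +
   (lambda ^+ 2 * t * (3 + `|m|))%:E).
Proof.
move=> t0 t1.
have mF n := measurable_upper_approx t n.
apply: (@le_trans _ _ (\int[P]_w limn_einf (upper_approx t ^~ w))).
  apply: ae_le_integral_measurable_r.
  - by move=> w; rewrite lee_fin integrand_ge0.
  - move=> w; apply: (@cvg_le_limn_einf _ (cst 0)); first exact: cvg_cst.
    by move=> n; exact: upper_approx_ge0.
  - rewrite (_ : (fun w => _) = (fun w => - limn_esup (fun n => - upper_approx t n w))).
      apply: measurableT_comp => //; apply: measurable_fun_limn_esup => n.
      exact: measurableT_comp.
    by apply/funext => w; rewrite -limn_einfN; congr limn_einf; apply/funext => n /=; rewrite oppeK.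
  - by apply: filterS ae_regular_path => w rw; exact: integrand_le_upper_approx.
apply: (le_trans (fatou _ _ mF _)) => //; first by move=> n w _; exact: upper_approx_ge0.
by apply: limn_einf_le => n; exact: integral_upper_approx_le.
Qed.

(* The jump is of size [x] and the continuous part stays below [x / 2], so that the
   level [x] is not reached before the jump. *)
Definition lower_event (t : R) : set T :=
  partial_sum Y 1 @^-1` [set x] `&` ~` exceeds W m (x / 2) t.

Lemma measurable_lower_event t : measurable (lower_event t).
Proof.
apply: measurableI; first exact: measurable_funPTI.
by apply: measurableC; exact: measurable_exceeds.
Qed.

Definition lower_approx (t Th : R) n (w : T) : \bar R :=
  \sum_(j < n.+1) (pos_term t Th n j w * (\1_(lower_event t) w)%:E).

Lemma lower_approx_ge0 t Th n w : 0 <= lower_approx t Th n w.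
Proof. by apply: sume_ge0 => j _; rewrite mule_ge0 ?pos_term_ge0// lee_fin. Qed.

Lemma measurable_lower_term t Th n j :
  measurable_fun setT (fun w => pos_term t Th n j w * (\1_(lower_event t) w)%:E).
Proof.
apply: emeasurable_funM; first exact: measurable_pos_term.
by apply/measurable_EFinP; apply: measurable_indic; exact: measurable_lower_event.
Qed.

Lemma measurable_lower_approx t Th n : measurable_fun setT (lower_approx t Th n).
Proof. by apply: emeasurable_sum => j; exact: measurable_lower_term. Qed.

(** The estimate of [ftilde_le] at the least remaining time t cos^2 Th. *)
Definition kernel_bound (t Th : R) : R := (1 + `|m| * Num.sqrt t) / (t * cos Th ^+ 2).

(** * The lower bound on a truncated grid *)

Section lower_bound.
Variables (t Th : R).
Hypotheses (t0 : (0 < t)%R) (Th0 : (0 < Th)%R) (Thpi : (Th < pi / 2)%R).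

Let Thpi' : (Th <= pi / 2)%R := ltW Thpi.

Let cosTh : (0 < cos Th)%R.
Proof.
by rewrite cos_gt0_pihalf// Thpi andbT (lt_trans _ Th0)// oppr_lt0.
Qed.

Lemma kernel_bound_ge0 : (0 <= kernel_bound t Th)%R.
Proof.
apply: divr_ge0; last by rewrite mulr_ge0 ?sqr_ge0 ?(ltW t0).
by rewrite addr_ge0// mulr_ge0 ?sqrtr_ge0.
Qed.

Lemma pos_kernel_bounded n j z : (j < n.+1)%N -> (pos_kernel t Th n j z <= kernel_bound t Th)%R.
Proof.
move=> jn; apply: (le_trans (ftilde_pos_le _ _ _)); apply: ftilde_le.
- by rewrite mulr_gt0// exprn_gt0.
- rewrite ler_wpM2l ?(ltW t0)// !cos2sin2 lerD2l lerN2.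
  have /andP[h1 h2] := gtag_itv Th0 Thpi' jn.
  by apply: sin_sqr_le; rewrite ?(ltW h1) ?(ltW h2).
- by rewrite ger_pMr// cos2sin2 gerBl sqr_ge0.
Qed.

(** Dominated convergence needs a true limit. It is 0 unless there is one jump, before the end of
    the truncated grid, on [lower_event]; then exactly one cell contributes, and its kernel tends to
    [ftilde_pos] at the actual jump time. *)
Lemma lower_approx_cvg w : regular_path W N w ->
  exists2 l : R, lower_approx t Th n w @[n --> \oo] --> l%:E & (l <= integrand t w)%R.
Proof.
move=> rw; have [W0 Wc N0 Nnd Nrc] := rw.
have zero : (forall n j, (j < n.+1)%N ->
   pos_term t Th n j w * (\1_(lower_event t) w)%:E = 0) ->
  exists2 l : R, lower_approx t Th n w @[n --> \oo] --> l%:E & (l <= integrand t w)%R.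
  move=> h; exists 0%R; last exact: integrand_ge0.
  rewrite (_ : (fun n => _) = cst 0); first exact: cvg_cst.
  by apply/funext => n; apply: big1 => j _; exact: h.
have [Dw|Dw] := pselect (lower_event t w); last first.
  by apply: zero => n j jn; rewrite [X in _ * X%:E]indicE memNset// mule0.
have [Nt|Nt] := pselect (N t w = 1%N); last first.
  apply: zero => n j jn; rewrite /pos_term [X in _ * X%:E * _]indicE memNset ?mule0 ?mul0e//.
  by move=> [_ /= h]; apply: Nt.
have Nt0 : (0 < N t w)%N by rewrite Nt.
have [tau0 taut Ntau hlt] := @last_jump_time_spec R T N w N0 Nnd Nrc t (ltW t0) Nt0.
have cellP n j (jn : (j < n.+1)%N) := jump_cellP rw t0 Th0 Thpi' jn Nt0.
have [tauTh|tauTh] := leP (TN t w) (t * sin Th ^+ 2)%R; last first.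
  apply: zero => n j jn; rewrite /pos_term [X in _ * X%:E * _]indicE memNset ?mule0 ?mul0e//.
  move=> /cellP => /(_ jn) [_ /andP[_ h]]; move: tauTh; rewrite ltNge => /negP; apply.
  apply: (le_trans h); rewrite /grid_time ler_wpM2l ?(ltW t0)//.
  apply: sin_sqr_le => //; first by rewrite theta_ge0// ltW.
  by rewrite -[leRHS](thetan Th n) theta_le// ltW.
have [jn [jnn jni cu cz]] := @tag_approx R T W N Y m x t Th w rw t0 Th0 Thpi' Nt0 tauTh.
have tau_lt : (TN t w < t)%R.
  apply: (le_lt_trans tauTh); rewrite gtr_pMr// sin2cos2 gtrBl exprn_gt0//.
have ttau0 : (0 < t - TN t w)%R by rewrite subr_gt0.
have ul0 n : (0 < tag_left t Th n (jn n))%R by exact: tag_left_gt0.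
have inJ n : jump_cell t Th n (jn n) 1 w by apply/cellP => //; split.
have E n : lower_approx t Th n w = (ftilde_pos m (tag_left t Th n (jn n))
     (tag_value W Y m x t Th 1 n (jn n) w))%:E.
  rewrite /lower_approx (bigD1 (Ordinal (jnn n)))//= big1 ?adde0.
    by rewrite /pos_term !indicE !mem_set// !mule1.
  move=> j jjn; rewrite /pos_term [X in _ * X%:E * _]indicE memNset ?mule0 ?mul0e//.
  move=> /(cellP _ _ (ltn_ord j)) [_ /andP[h1 h2]].
  have /andP[h3 h4] := jni n.
  have mono i k : (i < k)%N -> (k < n.+1)%N ->
      (grid_time t Th n i.+1 <= grid_time t Th n k)%R.
    move=> ik kn; rewrite /grid_time ler_wpM2l ?(ltW t0)// sin_sqr_le//.
    - by rewrite theta_ge0// ltW.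
    - by rewrite theta_le// ltW.
    - rewrite (le_trans _ (thetaS_pihalf Th0 Thpi' kn))// ltW// thetaS_lt//.
  have : nat_of_ord j != jn n by apply: contraNneq jjn => jE; apply/eqP/val_inj.
  rewrite neq_ltn => /orP[jlt|jgt].
  - have := mono _ _ jlt (jnn n); move=> /(lt_le_trans (lt_le_trans h3 h2)).
    by rewrite ltxx.
  - have := mono _ _ jgt (ltn_ord j); move=> /(lt_le_trans (lt_le_trans h1 h4)).
    by rewrite ltxx.
exists (ftilde_pos m (t - TN t w) (x - X (TN t w) w)).
  rewrite (_ : (fun n => _) = (fun n => (ftilde_pos m (tag_left t Th n (jn n))
     (tag_value W Y m x t Th 1 n (jn n) w))%:E)); last exact/funext.
  apply: cvg_EFin; first exact: nearW.
  by rewrite Nt in cz; exact: cvg_ftilde_pos_cont cu cz.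
rewrite /integrand /ftilde_pos subr_gt0; case: ltP => Xx; last exact: integrand_ge0.
rewrite indicE mem_set ?mul1r//=.
apply: (@hitting_after_jump R T W N Y m x t w rw t0 Nt) => //.
move=> q q0t; rewrite leNgt; apply/negP => hq; apply: Dw.2.
by exists q.
Qed.

(** The cells are disjoint, so at most one term is nonzero and the bound does not grow with [n]. *)
Lemma lower_approx_bounded n w : regular_path W N w ->
  lower_approx t Th n w <= (kernel_bound t Th)%:E.
Proof.
move=> rw; have [W0 Wc N0 Nnd Nrc] := rw.
have [[j Jj]|nJ] := pselect (exists j : 'I_n.+1, jump_cell t Th n j 1 w); last first.
  rewrite /lower_approx big1 ?lee_fin ?kernel_bound_ge0// => j _.
  rewrite /pos_term [X in _ * X%:E * _]indicE memNset ?mule0 ?mul0e//.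
  by move=> h; apply: nJ; exists j.
have Nt : N t w = 1%N by have [_ /= h] := Jj.
have Nt0 : (0 < N t w)%N by rewrite Nt.
have cellP k (kn : (k < n.+1)%N) := jump_cellP rw t0 Th0 Thpi' kn Nt0.
have [_ /andP[h3 h4]] := (cellP j (ltn_ord j) 1%N).1 Jj.
rewrite /lower_approx (bigD1 j)//= big1 ?adde0.
  rewrite /pos_term indicE mem_set// mule1 -EFinM lee_fin indicE.
  apply: (@le_trans _ _ (pos_kernel t Th n j (W (tag_time t Th n j) w, partial_sum Y 1 w))).
    by rewrite ler_piMr ?ftilde_pos_ge0// lern1 leq_b1.
  exact: pos_kernel_bounded.
move=> i ij; rewrite /pos_term [X in _ * X%:E * _]indicE memNset ?mule0 ?mul0e//.
move=> /(cellP _ (ltn_ord i)) [_ /andP[h1 h2]].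
have mono i' k : (i' < k)%N -> (k < n.+1)%N ->
    (grid_time t Th n i'.+1 <= grid_time t Th n k)%R.
  move=> ik kn; rewrite /grid_time ler_wpM2l ?(ltW t0)// sin_sqr_le//.
  - by rewrite theta_ge0// ltW.
  - by rewrite theta_le// ltW.
  - rewrite (le_trans _ (thetaS_pihalf Th0 Thpi' kn))// ltW// thetaS_lt//.
have : nat_of_ord i != j by apply: contraNneq ij => iE; apply/eqP/val_inj.
rewrite neq_ltn => /orP[ilt|igt].
- by have := mono _ _ ilt (ltn_ord j) => /(lt_le_trans (lt_le_trans h3 h2)); rewrite ltxx.
- by have := mono _ _ igt (ltn_ord i) => /(lt_le_trans (lt_le_trans h1 h4)); rewrite ltxx.
Qed.

Lemma lower_approx_integrand_le (c : \bar R) :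
  (forall n, c <= \int[P]_w lower_approx t Th n w) -> c <= \int[P]_w (integrand t w)%:E.
Proof.
(* The upper limit is an everywhere defined measurable version of a limit known to exist almost
   surely. *)
move=> hc; pose g w := limn_esup (lower_approx t Th ^~ w).
have mg : measurable_fun setT g.
  by apply: measurable_fun_limn_esup => n; exact: measurable_lower_approx.
have fg : {ae P, forall w, setT w -> lower_approx t Th ^~ w @ \oo --> g w}.
  apply: filterS ae_regular_path => w rw _.
  by have [l hl _] := lower_approx_cvg rw; rewrite /g (cvg_limn_einf_sup hl).2.
have bd : {ae P, forall w n, setT w -> `|lower_approx t Th n w| <= (cst (kernel_bound t Th)%:E w)}.
  apply: filterS ae_regular_path => w rw n _.
  by rewrite gee0_abs ?lower_approx_ge0// lower_approx_bounded.
have ib : P.-integrable setT (cst (kernel_bound t Th)%:E).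
  by apply: finite_measure_integrable_cst.
have [_ _ cvi] := dominated_convergence measurableT
  (fun n => measurable_lower_approx t Th n) mg fg ib bd.
apply: (@le_trans _ _ (\int[P]_w g w)).
  rewrite -(cvg_lim _ cvi)//; apply: lime_ge; first by apply/cvg_ex; eexists; exact: cvi.
  exact: nearW.
have g0 w : 0 <= g w.
  rewrite /g; apply: le_trans (limn_einf_sup _).
  apply: (@cvg_le_limn_einf _ (cst 0)); first exact: cvg_cst.
  by move=> n; exact: lower_approx_ge0.
apply: ae_le_integral_measurable_l => //.
- by move=> w; rewrite lee_fin integrand_ge0.
- apply: filterS ae_regular_path => w rw.
  by have [l hl hle] := lower_approx_cvg rw; rewrite /g (cvg_limn_einf_sup hl).2 lee_fin.
Qed.

Let K j n : R := (expR (- (m ^+ 2 * t / 2)) / (2 * pi * t) * gtan Th n j)%R.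

Let step0 n j : (j < n.+1)%N -> (0 <= step Th n j)%R.
Proof. exact: step_ge0. Qed.

Let K_ge0 n j : (j < n.+1)%N -> (0 <= K j n)%R.
Proof.
move=> jn; apply: mulr_ge0; last by rewrite ltW// gtan_gt0.
by rewrite divr_ge0 ?expR_ge0// !mulr_ge0 ?pi_ge0 ?(ltW t0).
Qed.

Lemma integral_pos_term_diag n j : (j < n.+1)%N ->
  \int[P]_w (pos_term t Th n j w * (\1_(partial_sum Y 1 @^-1` [set x]) w)%:E) =
  P (jump_cell t Th n j 1) * ((K j n)%:E * P (partial_sum Y 1 @^-1` [set x])).
Proof.
move=> jn.
(* The constraint on the jump size joins the function of the pair, so that the product formula
   applies. *)
pose h (z : R * R) : R := (pos_kernel t Th n j z * \1_[set x] z.2)%R.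
transitivity (\int[P]_w ((h (W (tag_time t Th n j) w, partial_sum Y 1 w))%:E *
    (\1_(jump_cell t Th n j 1) w)%:E)).
  apply: eq_integral => w _; rewrite /pos_term /h/= EFinM muleAC; congr (_ * _ * _).
have mh : measurable_fun setT h.
  apply: measurable_funM; first exact: measurable_pos_kernel.
  by apply: measurableT_comp => //; exact: measurable_indic.
transitivity (P (jump_cell t Th n j 1) * \int[distribution P (partial_sum Y 1)]_y
   \int[normal_prob 0 (Num.sqrt (tag_time t Th n j))]_a (h (a, y))%:E).
  apply: (integral_indep brownianW indepWNY) => //.
  - exact: tag_time_gt0.
  - exact: measurable_jump_cell.
  - exact: sigma_generated_jump_cell.
  - by move=> z; rewrite mulr_ge0 ?ftilde_pos_ge0// indicE.
have K0 : (0 <= K j n)%R by exact: K_ge0.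
set I := (X in _ * X = _); suff -> : I = (K j n)%:E * P (partial_sum Y 1 @^-1` [set x]) by [].
rewrite {}/I; transitivity (\int[distribution P (partial_sum Y 1)]_y ((K j n)%:E * (\1_[set x] y)%:E)); last first.
  rewrite ge0_integralZl_EFin//; last by apply/measurable_EFinP; exact: measurable_indic.
  by rewrite integral_indic// setIT.
apply: eq_integral => y _; have [->|yx] := eqVneq y x.
  rewrite indicE mem_set// mule1 -integral_pos_kernel_diag//.
  by apply: eq_integral => a _; rewrite /h/= indicE mem_set// mulr1.
rewrite indicE memNset; last exact/eqP.
rewrite mule0; apply: integral0_eq => a _.
by rewrite /h/= indicE memNset ?mulr0//; exact/eqP.
Qed.

(** The excursion event and the kernel both depend on [W], so they cannot be separated by
    independence. Where the excursion occurs, the kernel is first replaced by its bound; what is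
    left is the probability of a cell and an excursion, which factors. The cell widths then sum to
    at most t. *)
Lemma lower_approx_main n :
  (lambda * expR (- (lambda * t)) * expR (- (m ^+ 2 * t / 2)) * alpha Th / (2 * pi))%:E *
    P (partial_sum Y 1 @^-1` [set x]) <=
  \int[P]_w lower_approx t Th n w +
    (kernel_bound t Th * lambda * t)%:E * P (exceeds W m (x / 2) t).
Proof.
set D1 := partial_sum Y 1 @^-1` [set x]; set E := exceeds W m (x / 2) t.
have mD1 : measurable D1 by exact: measurable_funPTI.
have mE : measurable E by exact: measurable_exceeds.
have C0 := kernel_bound_ge0.
have split_term j : (j < n.+1)%N ->
  P (jump_cell t Th n j 1) * ((K j n)%:E * P D1) <=
  \int[P]_w (pos_term t Th n j w * (\1_(lower_event t) w)%:E) +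
  (kernel_bound t Th * lambda * (t * step Th n j))%:E * P E.
  move=> jn; rewrite -integral_pos_term_diag//.
  apply: (@le_trans _ _ (\int[P]_w (pos_term t Th n j w * (\1_(lower_event t) w)%:E +
      (kernel_bound t Th)%:E * (\1_(jump_cell t Th n j 1 `&` E) w)%:E))).
    apply: ae_le_integral_measurable_r.
    - by move=> w; rewrite mule_ge0 ?pos_term_ge0// lee_fin.
    - by move=> w; rewrite adde_ge0// mule_ge0 ?pos_term_ge0// lee_fin.
    - apply: emeasurable_funD; first exact: measurable_lower_term.
      apply: emeasurable_funM => //; apply/measurable_EFinP; apply: measurable_indic.
      by apply: measurableI => //; exact: measurable_jump_cell.
    - apply: aeW => w; have [D1w|D1w] := pselect (D1 w); last first.
        rewrite [X in _ * X%:E <= _]indicE memNset// mule0.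
        by rewrite adde_ge0// mule_ge0 ?pos_term_ge0// lee_fin.
      have [Ew|Ew] := pselect (E w); last first.
        rewrite !indicE (mem_set D1w) (mem_set (conj D1w Ew : lower_event t w)).
        by rewrite leeDl// mule_ge0// lee_fin.
      have [Jw|Jw] := pselect (jump_cell t Th n j 1 w); last first.
        have -> : pos_term t Th n j w = 0 by rewrite /pos_term indicE memNset// mule0.
        by rewrite !mul0e add0e mule_ge0// lee_fin.
      rewrite /pos_term [in leLHS]indicE (mem_set Jw) mule1 [in leLHS]indicE (mem_set D1w) mule1.
      rewrite [X in _ + _ * X%:E]indicE (mem_set (conj Jw Ew : (jump_cell t Th n j 1 `&` E) w)) mule1.
      apply: (@le_trans _ _ (kernel_bound t Th)%:E); first by rewrite lee_fin pos_kernel_bounded.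
      by rewrite leeDr// !mule_ge0// lee_fin ftilde_pos_ge0.
  have m2 : measurable_fun setT (fun w => (kernel_bound t Th)%:E * (\1_(jump_cell t Th n j 1 `&` E) w)%:E).
    apply: emeasurable_funM => //; apply/measurable_EFinP; apply: measurable_indic.
    by apply: measurableI => //; exact: measurable_jump_cell.
  have p1 w : setT w -> 0 <= pos_term t Th n j w * (\1_(lower_event t) w)%:E.
    by move=> _; rewrite mule_ge0 ?pos_term_ge0// lee_fin.
  have p2 w : setT w -> 0 <= (kernel_bound t Th)%:E * (\1_(jump_cell t Th n j 1 `&` E) w)%:E.
    by move=> _; rewrite mule_ge0// lee_fin.
  rewrite (ge0_integralD _ measurableT p1 (measurable_lower_term t Th n j) p2 m2).
  rewrite leeD2l// ge0_integralZl_EFin//; last first.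
    apply/measurable_EFinP; apply: measurable_indic.
    by apply: measurableI => //; exact: measurable_jump_cell.
  rewrite integral_indic//; last by apply: measurableI => //; exact: measurable_jump_cell.
  rewrite setIT.
  have PJE : P (jump_cell t Th n j 1 `&` E) = P (jump_cell t Th n j 1) * P E.
    by apply: (P_indep_exceeds indepWNY); exact: sigma_generated_jump_cell.
  apply: (@le_trans _ _ ((kernel_bound t Th)%:E * (P (jump_cell t Th n j 1) * P E))).
    by rewrite -PJE; exact: lexx.
  rewrite -mulrA [in leRHS]EFinM -[leRHS]muleA lee_wpmul2l ?lee_fin//.
  rewrite lee_wpmul2r ?measure_ge0// -grid_timeSB.
  apply: (P_last_jump_in1_le lambda_gt0 poissonN); first exact: grid_time_ge0.
  by apply: ltW; exact: grid_timeS_lt.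
have PE0 : 0 <= P E by exact: measure_ge0.
apply: (@le_trans _ _ (\sum_(j < n.+1)
    (P (jump_cell t Th n j 1) * ((K j n)%:E * P D1)))).
  pose q := (lambda * expR (- (lambda * t)) * t)%R.
  apply: (@le_trans _ _ (\sum_(j < n.+1) ((q * step Th n j * K j n)%:E * P D1))).
    rewrite -ge0_sume_distrl; last first.
      move=> j _; have Kj := K_ge0 (ltn_ord j); have sj := step0 (ltn_ord j).
      by rewrite lee_fin mulr_ge0// mulr_ge0// !mulr_ge0 ?expR_ge0 ?(ltW t0) ?(ltW lambda_gt0).
    rewrite lee_wpmul2r ?measure_ge0// sumEFin lee_fin le_eqVlt; apply/orP; left; apply/eqP.
    rewrite (eq_bigr (fun j : 'I_n.+1 => (q * (expR (- (m ^+ 2 * t / 2)) / (2 * pi * t))) *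
       (step Th n j * gtan Th n j)))%R; last by move=> j _; rewrite /K; ring.
    rewrite -mulr_sumr sum_step_gtan// /q.
    have p0 : (0 < pi :> R)%R by exact: pi_gt0.
    move: (pi) p0 (alpha Th) (expR _) (expR _) => p p0 a e1 e2.
    by field; rewrite !gt_eqF.
  apply: lee_sum => j _; have jn := ltn_ord j.
  rewrite [X in X%:E * _](_ : _ = (lambda * (t * step Th n j) * expR (- (lambda * t))) * K j n)%R; last by rewrite /q; ring.
  rewrite EFinM -muleA; apply: lee_wpmul2r.
    by rewrite mule_ge0 ?measure_ge0// lee_fin K_ge0.
  rewrite -grid_timeSB; apply: (P_last_jump_in1_ge lambda_gt0 poissonN).
  - exact: grid_time_ge0.
  - exact: grid_timeS_lt.
  - exact: grid_time_le.
apply: (@le_trans _ _ (\sum_(j < n.+1)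
   (\int[P]_w (pos_term t Th n j w * (\1_(lower_event t) w)%:E) +
  (kernel_bound t Th * lambda * (t * step Th n j))%:E * P E))).
  by apply: lee_sum => j _; exact: split_term.
rewrite big_split/= leeD//.
  rewrite ge0_integral_sum//.
  - by move=> j; exact: measurable_lower_term.
  - by move=> j w _; apply: mule_ge0; [exact: pos_term_ge0|rewrite lee_fin].
rewrite -ge0_sume_distrl; last first.
  move=> j _; have sj := step0 (ltn_ord j); have kl := mulr_ge0 C0 (ltW lambda_gt0).
  by rewrite lee_fin (mulr_ge0 kl)// mulr_ge0// ltW.
rewrite lee_wpmul2r// sumEFin lee_fin -!mulr_sumr sum_step.
rewrite ler_wpM2l//; first by apply: mulr_ge0 => //; exact: ltW.
by rewrite ler_piMr ?(ltW t0)// sin2cos2 gerBl sqr_ge0.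
Qed.

Lemma integrand_lower_bound :
  (lambda * expR (- (lambda * t)) * expR (- (m ^+ 2 * t / 2)) * alpha Th / (2 * pi))%:E *
    P (partial_sum Y 1 @^-1` [set x]) <=
  \int[P]_w (integrand t w)%:E +
    (kernel_bound t Th * lambda * t)%:E * P (exceeds W m (x / 2) t).
Proof.
have fE : (kernel_bound t Th * lambda * t)%:E * P (exceeds W m (x / 2) t) \is a fin_num.
  by rewrite fin_numM// fin_num_measure//; exact: measurable_exceeds.
rewrite -leeBlDr//; apply: lower_approx_integrand_le => n.
by rewrite leeBlDr//; exact: lower_approx_main.
Qed.

End lower_bound.

End last_jump_expectation.

(** * Passage to the limit as the time tends to 0 *)

(** The minorant may depend on [e], as it does below through [Th], which has to stay below pi/2. *)
Lemma squeeze_cvgr_approx (R : realType) (u v : R^nat) (p : R) :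
  u @ \oo --> p -> (\forall n \near \oo, v n <= u n) ->
  (forall e, 0 < e -> exists2 c : R, p - e < c &
    exists2 l : R^nat, l @ \oo --> c & \forall n \near \oo, l n <= v n) ->
  v @ \oo --> p.
Proof.
move=> up vu hl; apply/cvgrPdist_lt => e e0.
have [c pec [l lc lv]] := hl e e0.
have h1 := @cvgr_gt _ _ _ _ _ _ lc _ pec.
have pe : p < p + e by rewrite ltrDl.
have h2 := @cvgr_lt _ _ _ _ _ _ up _ pe.
near=> n; rewrite ltr_norml.
have a1 : v n <= u n by near: n; exact: vu.
have a2 : l n <= v n by near: n; exact: lv.
have a3 : p - e < l n by near: n; exact: h1.
have a4 : u n < p + e by near: n; exact: h2.
by apply/andP; split; lra.
Unshelve. all: by end_near. Qed.

Lemma cvg_integral_diag_limit (R : realType) (mu : probability R R)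
    (m lambda x : R) (s : R^nat) : 0 < lambda -> (forall n, 0 < s n) ->
    (forall n, s n <= 1) -> s @ \oo --> 0 ->
  (\int[mu]_y (lambda * diag_limit m x (s n) y)%:E)%E @[n --> \oo]
    --> ((lambda / 4)%:E * mu [set x])%E.
Proof.
move=> l0 s0 s1 scv.
have mx : measurable_fun setT (\1_[set x] : R -> R) by exact: measurable_indic.
have <- : (\int[mu]_y ((lambda / 4) * \1_[set x] y)%:E = (lambda / 4)%:E * mu [set x])%E.
  under eq_integral do rewrite EFinM.
  rewrite ge0_integralZl_EFin//; last by rewrite divr_ge0// ltW.
    by rewrite integral_indic// setIT.
  exact/measurable_EFinP.
(* 4 + |m| dominates both the value 1/4 at [x] and the bound 3 + |m| elsewhere. *)
apply: (@dominated_cvg _ _ _ mu setT measurableT _ _ (cst (lambda * (4 + `|m|))%:E)).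
- move=> n; apply/measurable_EFinP; apply: measurable_funM => //.
  exact: measurable_diag_limit.
- move=> y _; apply: cvg_EFin; first exact: nearW.
  rewrite -mulrA; apply: cvgM; first exact: cvg_cst.
  rewrite /diag_limit indicE; case: eqVneq => [->|yx].
    by rewrite mem_set//= mulr1 div1r; exact: cvg_cst.
  rewrite memNset ?mulr0; last exact/eqP.
  by apply: cvg_gauss_sum => //; rewrite subr_eq0 eq_sym.
- by [].
- exact: finite_measure_integrable_cst.
- move=> n y _; rewrite abse_EFin lee_fin ger0_norm; last first.
    by rewrite mulr_ge0 ?diag_limit_ge0// ltW.
  rewrite ler_wpM2l ?(ltW l0)// /diag_limit; case: ifP => _.
    by have := normr_ge0 m; lra.
  by apply: (le_trans (gauss_sum_le m (x - y) (s0 n) (s1 n))); lra.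
Qed.

Theorem proposition3 (R : realType) (d : measure_display)
    (T : measurableType d) (P : probability T R) (m lambda : R)
    (W : R -> {RV P >-> R}) (N : R -> {RV P >-> nat})
    (Y : nat -> {RV P >-> R}) (x : R)
    (lambda_gt0 : 0 < lambda)
    (brownianW : brownian_motion W)
    (poissonN : poisson_process lambda N)
    (iidY : iid Y)
    (indepWNY : independent_processes W N Y)
    (x_gt0 : 0 < x) :
  let X : R -> T -> R := jump_diffusion m W N Y in
  let TN : R -> T -> R := last_jump_time N in
  let tau : T -> \bar R := hitting_time X x in
  ('E_P[fun w => (\1_[set w' | ((TN t w')%:E < tau w')%E] w *
                  ftilde m (t - TN t w) (x - X (TN t w) w))%R])%E @[t --> 0^'+]
    --> ((lambda / 4)%:E *
         (cdf (Y 0%N) x - lim (cdf (Y 0%N) y @[y --> x^'-])))%E.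
Proof.
move=> X TN tau; rewrite cdf_jump.
have S1 : partial_sum Y 1 = Y 0%N :> (T -> R).
  by apply/funext => w; rewrite /partial_sum big_ord1.
set q := P (Y 0%N @^-1` [set x]).
have q01 : exists2 r : R, 0 <= r & q = r%:E.
  exists (fine q); first by rewrite fine_ge0// measure_ge0.
  by rewrite fineK// fin_num_measure//; exact: measurable_funPTI.
have [r r0 qr] := q01.
rewrite qr -EFinM.
rewrite (_ : (fun t : R => _) = (fun t => \int[P]_w (integrand m W N Y x t w)%:E)%E); last first.
  by apply/funext => t; rewrite unlock.
apply/cvge_at_rightP => t [t0 tcv].
(* Capping at 1 makes the bounds for times at most 1 valid at every index; the two sequences agree
   eventually. *)
pose s n := Num.min (t n) 1.
have s0 n : 0 < s n by rewrite lt_min t0/=.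
have s1 n : s n <= 1 by rewrite ge_min lexx orbT.
have t1 : \forall n \near \oo, t n < 1 by apply: (@cvgr_lt _ _ _ _ _ _ tcv).
have scv : s @ \oo --> 0.
  apply: cvg_trans tcv; apply: near_eq_cvg; near=> n; rewrite /s min_l// ltW//.
  by near: n.
suff : (\int[P]_w (integrand m W N Y x (s n) w)%:E)%E @[n --> \oo] --> (lambda / 4 * r)%:E.
  apply: cvg_trans; apply: near_eq_cvg; near=> n; rewrite /s min_l// ltW//.
  by near: n.
have x0 : x != 0 by rewrite gt_eqF.
pose nu : probability R R := distribution P (partial_sum Y 1).
have nux : nu [set x] = r%:E by rewrite -qr /q -S1.
have cvI := @cvg_integral_diag_limit R nu m lambda x s lambda_gt0 s0 s1 scv.
rewrite nux -EFinM in cvI.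
have [Ifin Icv] := (fine_cvgP _ _).1 cvI.
pose e n := (\int[P]_w (integrand m W N Y x (s n) w)%:E)%E.
pose I n := (\int[nu]_y (lambda * diag_limit m x (s n) y)%:E)%E.
have e_le n : (e n <= (ftilde m (s n) x)%:E + (I n + (lambda ^+ 2 * s n * (3 + `|m|))%:E))%E.
  exact: (integral_integrand_le m x lambda_gt0 brownianW poissonN indepWNY (s0 n) (s1 n)).
have e_ge0 n : (0 <= e n)%E by apply: integral_ge0 => w _; rewrite lee_fin integrand_ge0.
have efin : \forall n \near \oo, e n \is a fin_num.
  near=> n; rewrite ge0_fin_numE//; apply: (le_lt_trans (e_le n)).
  have In : I n \is a fin_num by near: n; exact: Ifin.
  by rewrite -(fineK In) -!EFinD ltry.
apply/fine_cvgP; split; first exact: efin.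
apply: (@squeeze_cvgr_approx _
  (fun n => ftilde m (s n) x + (fine (I n) + lambda ^+ 2 * s n * (3 + `|m|)))).
- rewrite -[in X in _ --> X](addr0 (_ * r)) -[in X in _ --> X](add0r (_ + 0)).
  apply: cvgD; first exact: cvg_ftilde.
  apply: cvgD; first exact: Icv.
  rewrite -(mul0r (3 + `|m|)) -(mulr0 (lambda ^+ 2)).
  by apply: cvgM; [apply: cvgM => //; exact: cvg_cst|exact: cvg_cst].
- near=> n; have In : I n \is a fin_num by near: n; exact: Ifin.
  have en : e n \is a fin_num by near: n; exact: efin.
  by rewrite -lee_fin (fineK en) EFinD EFinD (fineK In).
- move=> eps eps0.
  (* [Th] is fixed before [n], by continuity of [alpha] at pi/2, so that 1/cos^2 Th stays constant
     while the excursion probability tends to 0. *)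
  have [Th [Th0 Thpi pTh]] : exists Th : R, [/\ 0 < Th, Th < pi / 2 &
      lambda / 4 * r - eps < lambda * alpha Th / (2 * pi) * r].
    have p0 : 0 < pi / 2 :> R by rewrite divr_gt0 ?pi_gt0.
    have ac : {for (pi / 2 : R), continuous alpha}.
      have [dv _] := is_derive_alpha (pi / 2 : R).
      by apply: differentiable_continuous; apply/derivable1_diffP.
    have cc : lambda * alpha Th / (2 * pi) * r @[Th --> (pi / 2 : R)^'-] --> lambda / 4 * r.
      have -> : lambda / 4 * r = lambda * alpha (pi / 2) / (2 * pi) * r.
        rewrite alpha_pihalf; have := pi_gt0 R; move: (pi : R) => p pp; field; rewrite gt_eqF//.
      apply: cvg_at_left_filter; apply: cvgM; last exact: cvg_cst.
      by apply: cvgM; last exact: cvg_cst; apply: cvgM => //; exact: cvg_cst.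
    have pe : lambda / 4 * r - eps < lambda / 4 * r by rewrite gtrBl.
    have h1 := @cvgr_gt _ _ _ _ _ _ cc _ pe.
    near (pi / 2 : R)^'- => Th; exists Th; split.
    - by near: Th; exact: nbhs_left_gt.
    - by near: Th; exact: nbhs_left_lt.
    - by near: Th; exact: h1.
  pose PE n := P (exceeds W m (x / 2) (s n)).
  have PEfin n : PE n \is a fin_num by rewrite fin_num_measure//; exact: measurable_exceeds.
  have x2 : 0 < x / 2 by rewrite divr_gt0.
  have [_ PEcv] := (fine_cvgP _ _).1 (cvg_P_exceeds brownianW m x2 scv).
  exists (lambda * alpha Th / (2 * pi) * r) => //.
  exists (fun n => lambda * expR (- (lambda * s n)) * expR (- (m ^+ 2 * s n / 2)) *
     alpha Th / (2 * pi) * r - (1 + `|m| * Num.sqrt (s n)) / cos Th ^+ 2 * lambda * fine (PE n)).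
    have expR_cvg1 (u : R^nat) : u @ \oo --> 0 -> expR (u n) @[n --> \oo] --> (1 : R).
      by move=> ucv; rewrite -[X in _ --> X](@expR0 R); apply: continuous_cvg => //; exact: continuous_expR.
    rewrite [X in _ --> X](_ : _ = lambda * 1 * 1 * alpha Th / (2 * pi) * r -
       (1 + `|m| * 0) / cos Th ^+ 2 * lambda * 0); last by rewrite !mulr1 mulr0 subr0.
    apply: cvgB; last first.
      apply: cvgM PEcv; apply: cvgM; last exact: cvg_cst.
      apply: cvgM; last exact: cvg_cst.
      by apply: cvgD; [exact: cvg_cst|apply: cvgM; [exact: cvg_cst|exact: cvg_sqrt0]].
    do 3 (apply: cvgM; last exact: cvg_cst).
    apply: cvgM; [apply: cvgM|]; first exact: cvg_cst.
      apply: expR_cvg1; rewrite -oppr0 -(mulr0 lambda).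
      by apply: cvgN; apply: cvgM => //; exact: cvg_cst.
    apply: expR_cvg1; rewrite -oppr0 -(mul0r 2^-1) -(mulr0 (m ^+ 2)).
    by apply: cvgN; apply: cvgM; [apply: cvgM => //|]; exact: cvg_cst.
  near=> n.
  have en : e n \is a fin_num by near: n; exact: efin.
  rewrite lerBlDr -lee_fin [in leRHS]EFinD (fineK en) [in leLHS]EFinM.
  rewrite [X in (_ <= _ + X)%E]EFinM (fineK (PEfin n)).
  have := integrand_lower_bound m lambda_gt0 brownianW poissonN indepWNY x_gt0 (s0 n) Th0 Thpi.
  rewrite S1 -/q qr.
  (* The factor [s n] cancels the one in the denominator of [kernel_bound], so the coefficient of
     the excursion probability stays bounded. *)
  have -> : kernel_bound m (s n) Th * lambda * s n =
    (1 + `|m| * Num.sqrt (s n)) / cos Th ^+ 2 * lambda.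
    have c0 : 0 < cos Th by rewrite cos_gt0_pihalf// Thpi andbT (lt_trans _ Th0)// oppr_lt0 divr_gt0 ?pi_gt0.
    by rewrite /kernel_bound; field; rewrite !gt_eqF.
  by [].
Unshelve. all: by end_near. Qed.
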